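(* Let $-1<\lambda<1$ and $\alpha>0$. Then the operator $B(\lambda,\alpha)=\begin{bmatrix}B&\alpha S[\lambda]\\0&B\end{bmatrix}$ on $L^2(\mathbb T)\oplus L^2(\mathbb T)$ is irreducible.
   Context: $L^2(\mathbb T)$ is normalized so that $\{z^n\}_{n\in\mathbb Z}$ is an orthonormal basis. $B$ is the unweighted bi-lateral shift $Bz^n=z^{n+1}$ and $S[\lambda]$ is the weighted shift $S[\lambda]z^n=\frac1{\lambda+2n+1}z^{n+1}$, $n\in\mathbb Z$. An operator is irreducible if it has no non-trivial reducing subspace. *)

(* Defs.v *)
From HB Require Import structures.
From mathcomp Require Import all_boot all_order all_algebra.
From mathcomp Require Import generic_quotient ring_quotient.
From mathcomp Require Import all_classical all_reals all_analysis.
From mathcomp Require Import measurable_realfun complex.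
From mathcomp Require Import ring lra.

Set Implicit Arguments.
Unset Strict Implicit.
Unset Printing Implicit Defensive.
Import Order.TTheory GRing.Theory Num.Theory.
Import numFieldNormedType.Exports.
Import complex.
Local Open Scope classical_set_scope.
Local Open Scope ring_scope.
Local Open Scope quotient_scope.
Local Open Scope complex_scope.

Section L2_circle.
Variable R : realType.
Local Notation C := (R[i]).

Lemma twopi_gt0 : 0 < 2 * pi :> R.
Proof. by rewrite mulr_gt0 ?pi_gt0. Qed.

(* The circle is parametrized by the angle t in [0, 2 pi], with arc length
   divided by 2 pi, so that the functions z^n are orthonormal. Functions are
   defined on all of R, but their values outside [0, 2 pi] are disregarded:
   the complement of [0, 2 pi] is a null set. *)
Definition circle_meas : probability (measurableTypeR R) R :=
  uniform_prob twopi_gt0.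
Local Notation mu := circle_meas.

Definition circle_pt (t : R) : C := cos t +i* sin t.

Definition sqr_abs (z : C) : R := Normc.normc z ^+ 2.

Definition sq_integrable (f : R -> C) : Prop :=
  [/\ measurable_fun setT (fun t => Re (f t)),
      measurable_fun setT (fun t => Im (f t)) &
      (\int[mu]_t (sqr_abs (f t))%:E < +oo)%E].

Lemma sqr_absE (z : C) : sqr_abs z = Re z ^+ 2 + Im z ^+ 2.
Proof. by case: z => a b; rewrite /sqr_abs/= sqr_sqrtr// addr_ge0// sqr_ge0. Qed.

Lemma sqr_abs_ge0 (z : C) : 0 <= sqr_abs z.
Proof. exact: sqr_ge0. Qed.

Lemma sqr_abs0 : sqr_abs 0 = 0.
Proof. by rewrite sqr_absE/= expr0n addr0. Qed.

Lemma measurable_sqr_abs (f : R -> C) :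
  measurable_fun setT (fun t => Re (f t)) ->
  measurable_fun setT (fun t => Im (f t)) ->
  measurable_fun setT (EFin \o (fun t : R => sqr_abs (f t))).
Proof.
move=> mr mi; apply/measurable_EFinP.
under eq_fun do rewrite sqr_absE.
by apply: measurable_funD; exact: measurable_funX.
Qed.

(* [L2fun] is the space of square integrable functions, [L2] its quotient by
   the functions that vanish almost everywhere. *)
Definition L2pred : {pred R -> C} := fun f => `[< sq_integrable f >].

Lemma L2pred_submod_closed : submod_closed L2pred.
Proof.
split.
  apply/asboolP; split; [exact: (@measurable_cst _ _ _ _ _ (0 : R))|exact: (@measurable_cst _ _ _ _ _ (0 : R))|].
  under eq_integral do rewrite sqr_abs0.
  by rewrite integral0 ltry.
move=> a f g /asboolP[mfr mfi fI] /asboolP[mgr mgi gI]; apply/asboolP.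
have ReE : (fun t => Re ((a *: f + g) t)) =
    (fun t => Re a * Re (f t) - Im a * Im (f t) + Re (g t)).
  apply/funext => t; have -> : (a *: f + g) t = a * f t + g t by [].
  by case: (a) (f t) (g t) => ? ? [? ?] [? ?].
have ImE : (fun t => Im ((a *: f + g) t)) =
    (fun t => Re a * Im (f t) + Im a * Re (f t) + Im (g t)).
  apply/funext => t; have -> : (a *: f + g) t = a * f t + g t by [].
  by case: (a) (f t) (g t) => ? ? [? ?] [? ?].
have mr : measurable_fun setT (fun t => Re ((a *: f + g) t)).
  rewrite ReE; apply: measurable_funD => //; apply: measurable_funB;
    exact: measurable_funM.
have mi : measurable_fun setT (fun t => Im ((a *: f + g) t)).
  rewrite ImE; apply: measurable_funD => //; apply: measurable_funD;
    exact: measurable_funM.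
split=> //.
pose c : R := 2 * sqr_abs a.
have c0 : 0 <= c by rewrite mulr_ge0 ?sqr_abs_ge0.
have mf := measurable_sqr_abs mfr mfi.
have mg := measurable_sqr_abs mgr mgi.
apply: (@le_lt_trans _ _ (\int[mu]_t
    (c%:E * (sqr_abs (f t))%:E + 2%:E * (sqr_abs (g t))%:E))%E).
  apply: ge0_le_integral => //.
  - by move=> t _; rewrite lee_fin sqr_abs_ge0.
  - exact: measurable_sqr_abs.
  - by apply: emeasurable_funD; apply: emeasurable_funM.
  - move=> t _; rewrite -!EFinM -EFinD lee_fin /c !sqr_absE.
    move: (congr1 (@^~ t) ReE) (congr1 (@^~ t) ImE) => /= -> ->.
    set x := Re a; set y := Im a; set u := Re (f t); set v := Im (f t).
    set p := Re (g t); set q := Im (g t).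
    have h1 := sqr_ge0 (x * u - y * v - p).
    have h2 := sqr_ge0 (x * v + y * u - q).
    nra.
rewrite ge0_integralD//; first last.
- by apply: emeasurable_funM.
- by move=> t _; rewrite -EFinM lee_fin mulr_ge0 ?sqr_abs_ge0.
- by apply: emeasurable_funM.
- by move=> t _; rewrite -EFinM lee_fin mulr_ge0 ?sqr_abs_ge0.
rewrite !ge0_integralZl//;
  try (by move=> t _; rewrite lee_fin sqr_abs_ge0); try by rewrite lee_fin.
by rewrite lte_add_pinfty// lte_mul_pinfty// lee_fin.
Qed.

HB.instance Definition _ :=
  GRing.isSubmodClosed.Build C (R -> C) L2pred L2pred_submod_closed.

Record L2fun := MkL2fun { L2fun_val :> R -> C ; _ : L2fun_val \in L2pred }.
HB.instance Definition _ := [isSub for L2fun_val].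
HB.instance Definition _ := [Choice of L2fun by <:].
HB.instance Definition _ := [SubChoice_isSubLmodule of L2fun by <:].

Definition L2null : {pred L2fun} :=
  fun f => `[< {ae mu, forall t, (f : R -> C) t = 0} >].

Lemma L2null_submod_closed : submod_closed L2null.
Proof.
split; first by apply/asboolP; exact: aeW.
move=> a f g /asboolP f0 /asboolP g0; apply/asboolP.
have ae_filter : Filter (almost_everywhere mu).
  exact: ae_filter_ringOfSetsType.
move: f0 g0; apply: filterS2 => t /= ft gt.
by rewrite -[LHS]/(a * (f : R -> C) t + (g : R -> C) t) ft gt mulr0 addr0.
Qed.

HB.instance Definition _ :=
  GRing.isSubmodClosed.Build C L2fun L2null L2null_submod_closed.

Definition L2 : Type := {ideal_quot L2null}.
HB.instance Definition _ := GRing.Zmodule.on L2.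
HB.instance Definition _ := EqQuotient.on L2.

Definition L2scale (a : C) (x : L2) : L2 := \pi_L2 (a *: repr x).

Lemma L2scale_pi a (f : L2fun) : L2scale a (\pi_L2 f) = \pi_L2 (a *: f).
Proof.
apply/eqP; rewrite /L2scale -Quotient.idealrBE -scalerBr rpredZ//.
by rewrite Quotient.idealrBE reprK.
Qed.

Lemma L2_pi_add (f g : L2fun) : \pi_L2 f + \pi_L2 g = \pi_L2 (f + g).
Proof. exact: (esym (Quotient.pi_add L2null f g)). Qed.

Lemma L2scaleA a b x : L2scale a (L2scale b x) = L2scale (a * b) x.
Proof. by rewrite -[x]reprK (L2scale_pi b) (L2scale_pi a) (L2scale_pi (a * b)) scalerA. Qed.

Lemma L2scale1 : left_id 1 L2scale.
Proof. by move=> x; rewrite -[x]reprK L2scale_pi scale1r. Qed.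

Lemma L2scaleDr : right_distributive L2scale +%R.
Proof.
move=> a x y; rewrite -[x]reprK -[y]reprK.
by rewrite L2_pi_add !(L2scale_pi a) L2_pi_add scalerDr.
Qed.

Lemma L2scaleDl x : {morph L2scale^~ x : a b / a + b}.
Proof.
by move=> a b /=; rewrite -[x]reprK (L2scale_pi (a + b)) (L2scale_pi a) (L2scale_pi b) L2_pi_add scalerDl.
Qed.

HB.instance Definition _ := GRing.Zmodule_isLmodule.Build C L2
  L2scaleA L2scale1 L2scaleDr L2scaleDl.

Definition L2rep (x : L2) : R -> C := L2fun_val (repr x).

(* Integrals are invariant under a.e. equality, so the choice of
   representatives does not matter. *)
Definition L2ip (x y : L2) : C :=
  (\int[mu]_t Re (L2rep x t * (L2rep y t)^*)) +i*
  (\int[mu]_t Im (L2rep x t * (L2rep y t)^*)).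

Lemma circle_pt_expn (n : nat) (t : R) :
  circle_pt t ^+ n = circle_pt (n%:R * t).
Proof.
elim: n => [|n IH]; first by rewrite mul0r /circle_pt cos0 sin0.
rewrite exprS IH /circle_pt -addn1 natrD mulrDl mul1r cosD sinD.
by apply/eqP; rewrite eq_complex /=; apply/andP; split; apply/eqP; ring.
Qed.

Lemma circle_pt_exprz (n : int) (t : R) :
  circle_pt t ^ n = circle_pt (n%:~R * t).
Proof.
case: n => n; first by rewrite -exprnP circle_pt_expn pmulrn.
rewrite NegzE -exprnN circle_pt_expn mulrNz mulNr -pmulrn.
apply: mulr1_eq; rewrite /circle_pt cosN sinN; set u := _ * t.
apply/eqP; rewrite eq_complex /=; apply/andP; split; apply/eqP; last by ring.
by rewrite mulrN opprK -!expr2 cos2Dsin2.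
Qed.

Lemma monomial_L2 (n : int) : (fun t => circle_pt t ^ n) \in L2pred.
Proof.
apply/asboolP; split.
- under eq_fun do rewrite circle_pt_exprz /=.
  apply: measurableT_comp; last exact: measurable_funM.
  by apply: continuous_measurable_fun => x; exact: continuous_cos.
- under eq_fun do rewrite circle_pt_exprz /=.
  apply: measurableT_comp; last exact: measurable_funM.
  by apply: continuous_measurable_fun => x; exact: continuous_sin.
- under eq_integral do rewrite circle_pt_exprz sqr_absE /= cos2Dsin2.
  rewrite integral_cst// mul1e.
  by apply: (@le_lt_trans _ _ 1%E); [exact: (probability_le1 mu)|exact: ltry].
Qed.

(* The class of the function z^n, for n in Z. *)
Definition zpow (n : int) : L2 := \pi_L2 (MkL2fun (monomial_L2 n)).

End L2_circle.

Section Hilbert_operators.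
Variables (R : realType) (H : lmodType R[i]) (ip : H -> H -> R[i]).

Definition ip_norm (x : H) : R := Num.sqrt (Re (ip x x)).

Definition bounded_operator (T : {linear H -> H}) : Prop :=
  exists M : R, forall x, ip_norm (T x) <= M * ip_norm x.

Definition adjoint_pair (T T' : {linear H -> H}) : Prop :=
  forall x y, ip (T x) y = ip x (T' y).

Definition closed_subspace (M : set H) : Prop :=
  [/\ M 0,
      forall (a : R[i]) x y, M x -> M y -> M (a *: x + y) &
      forall x, (forall e : R, 0 < e -> exists2 y, M y & ip_norm (x - y) < e) ->
        M x].

Definition invariant (T : {linear H -> H}) (M : set H) : Prop :=
  forall x, M x -> M (T x).

(* Reducing means invariant under both T and its adjoint; the adjoint of a
   bounded operator on a Hilbert space is the unique T' with
   [adjoint_pair T T']. *)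
Definition reducing (T : {linear H -> H}) (M : set H) : Prop :=
  [/\ closed_subspace M, invariant T M &
      forall T' : {linear H -> H}, adjoint_pair T T' -> invariant T' M].

Definition irreducible (T : {linear H -> H}) : Prop :=
  forall M : set H, reducing T M -> M = [set 0] \/ M = setT.

End Hilbert_operators.

Section direct_sum.
Variables (R : realType) (H : lmodType R[i]).
Implicit Types A D E : {linear H -> H}.

Definition sum_ip (ip : H -> H -> R[i]) (x y : H * H) : R[i] :=
  ip x.1 y.1 + ip x.2 y.2.

(* The operator matrix [A D; 0 E]. *)
Definition upper_block A D E (x : H * H) : H * H := (A x.1 + D x.2, E x.2).

Lemma upper_block_linear A D E : linear (upper_block A D E).
Proof.
move=> a [x1 x2] [y1 y2]; congr pair => /=; rewrite !linearP//.
by rewrite scalerDr addrACA.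
Qed.

HB.instance Definition _ A D E :=
  GRing.isLinear.Build R[i] (H * H)%type (H * H)%type *:%R (upper_block A D E)
    (upper_block_linear A D E).

End direct_sum.

(* A bounded operator is determined by its values on the z^n, so there is
   exactly one such operator for each bounded sequence w. *)
Definition weighted_shift (R : realType) (w : int -> R)
    (T : {linear L2 R -> L2 R}) : Prop :=
  bounded_operator (@L2ip R) T /\
  forall n : int, T (zpow R n) = (w n)%:C *: zpow R (n + 1).

(* Main.v *)
(** Write T for the block operator, D = B^-1 S for the diagonal operator with
    weights d_n = 1 / (lambda + 2 n + 1), and a = alpha.  The adjoint of T needs
    no Riesz representation: B^* is multiplication by conj z and S = B D with D
    self-adjoint, so T^* is an explicit block operator.  Also N = T^* T has the
    explicit inverse [1 + a^2 D^2, - a D; - a D, 1].  A reducing subspace M is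
    invariant under N^-1, hence under Y = T (1 - N^-1) and Y^* = (1 - N^-1) T^*,
    which send (x, y) to (a B D y, a B D x) and (a D B^* y, a D B^* x).  Then
    Y^* Y + Y Y^* is the diagonal operator with entries
    a^2 (d_n^2 + d_{n-1}^2), repeated in both summands; for |lambda| < 1 the
    largest of these is attained at n = 0 only, so power iteration shows that M
    is invariant under the projection P onto E_0, the span of (1, 0) and (0, 1).
    On E_0 the operators Y^*^2 T^2 and Y^* T are nonzero multiples of
    [1, s; 0, 1] and [0, 1; 1, a d_0] with s = a (d_0 + d_1) <> 0, so P M is
    either E_0 or 0.  Moving along Y and Y^*, M is then everything or zero,
    because the z^n span a dense subspace of L^2.

    Density: the Borel sets whose indicator is an L^2 limit of trigonometric
    polynomials form a Dynkin system, which contains the rays ]a, +oo[ because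
    cos (a / 2) - cos (t - a / 2) has the sign of t - a on ]0, 2 pi[. *)
From HB Require Import structures.
From mathcomp Require Import all_boot all_order all_algebra.
From mathcomp Require Import generic_quotient ring_quotient finmap.
From mathcomp Require Import all_classical all_reals all_analysis.
From mathcomp Require Import measurable_realfun complex ring lra.
Require Import Defs.
Set Implicit Arguments.
Unset Strict Implicit.
Unset Printing Implicit Defensive.
Import Order.TTheory GRing.Theory Num.Theory.
Import numFieldNormedType.Exports.
Import complex.
Local Open Scope classical_set_scope.
Local Open Scope ring_scope.
Local Open Scope quotient_scope.
Local Open Scope complex_scope.

(** * Inner product spaces and orthonormal bases *)

Lemma conj_real (R : realType) (x : R) : (x%:C)^* = x%:C :> R[i].
Proof. exact: conjc_real. Qed.

(** Positivity and definiteness speak of real parts only; [ip_sym] makes [ip x x] real, see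
    [ip_self]. *)
Record inner_product (R : realType) (H : lmodType R[i]) (ip : H -> H -> R[i])
    : Prop := InnerProduct {
  ip_linear : forall a x y z, ip (a *: x + y) z = a * ip x z + ip y z;
  ip_sym : forall x y, ip y x = (ip x y)^*;
  ip_ge0 : forall x, 0 <= Re (ip x x);
  ip_eq0 : forall x, Re (ip x x) = 0 -> x = 0 }.

Section InnerProductTheory.
Variables (R : realType) (H : lmodType R[i]) (ip : H -> H -> R[i]).
Hypothesis ipP : inner_product ip.

Local Notation C := R[i].
Local Notation norm := (ip_norm ip).
Local Notation q x := (Re (ip x x)).

Lemma ipDl x y z : ip (x + y) z = ip x z + ip y z.
Proof. by rewrite -[x]scale1r (ip_linear ipP) scale1r mul1r. Qed.

Lemma ip0l z : ip 0 z = 0.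
Proof. by apply: (addrI (ip 0 z)); rewrite -ipDl !addr0. Qed.

Lemma ipZl a x z : ip (a *: x) z = a * ip x z.
Proof. by rewrite -[a *: x]addr0 (ip_linear ipP) ip0l addr0. Qed.

Lemma ipNl x z : ip (- x) z = - ip x z.
Proof. by rewrite -scaleN1r ipZl mulN1r. Qed.

Lemma ipBl x y z : ip (x - y) z = ip x z - ip y z.
Proof. by rewrite ipDl ipNl. Qed.

Lemma ipDr x y z : ip x (y + z) = ip x y + ip x z.
Proof. by rewrite !(ip_sym ipP _ x) ipDl rmorphD. Qed.

Lemma ip0r z : ip z 0 = 0.
Proof. by rewrite (ip_sym ipP) ip0l conjc0. Qed.

Lemma ipZr a x z : ip x (a *: z) = a^*%C * ip x z.
Proof. by rewrite !(ip_sym ipP _ x) ipZl rmorphM. Qed.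

Lemma ipNr x z : ip x (- z) = - ip x z.
Proof. by rewrite !(ip_sym ipP _ x) ipNl rmorphN. Qed.

Lemma ipBr x y z : ip x (y - z) = ip x y - ip x z.
Proof. by rewrite ipDr ipNr. Qed.

Lemma ip_suml (I : Type) (r : seq I) (F : I -> H) z :
  ip (\sum_(i <- r) F i) z = \sum_(i <- r) ip (F i) z.
Proof. by elim/big_rec2: _ => [|i y1 y2 _ <-]; rewrite ?ip0l ?ipDl. Qed.

Lemma ip_self x : ip x x = (q x)%:C.
Proof.
have := ip_sym ipP x x; case: (ip x x) => a b [bN] /=.
by congr (_ +i* _); lra.
Qed.

(** For y != 0 the squared norm of q(y) x - <x, y> y is nonnegative and equals q(y) (q(x) q(y) -
    |<x, y>|^2). *)
Lemma cauchy_schwarz x y : sqr_abs (ip x y) <= q x * q y.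
Proof.
have [y0|y_neq0] := eqVneq (q y) 0.
  by rewrite (ip_eq0 ipP y0) !ip0r sqr_abs0 mulr0.
have y_gt0 : 0 < q y by rewrite lt0r y_neq0 (ip_ge0 ipP).
have := ip_ge0 ipP ((q y)%:C *: x - ip x y *: y).
rewrite !(ipBl, ipBr, ipZl, ipZr) (ip_sym ipP x y) sqr_absE.
rewrite (ip_self x) (ip_self y).
case: (ip x y) => a b /= h; rewrite -subr_ge0 -(pmulr_rge0 _ y_gt0).
by apply: le_trans h _; rewrite le_eqVlt; apply/orP; left; apply/eqP; ring.
Qed.

Lemma sqr_norm x : norm x ^+ 2 = q x.
Proof. by rewrite sqr_sqrtr // (ip_ge0 ipP). Qed.

Lemma norm_ge0 x : 0 <= norm x. Proof. exact: sqrtr_ge0. Qed.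

Lemma norm_eq0 x : norm x = 0 -> x = 0.
Proof. by move=> x0; apply: (ip_eq0 ipP); rewrite -sqr_norm x0 expr0n. Qed.

Lemma norm_le x c : 0 <= c -> q x <= c ^+ 2 -> norm x <= c.
Proof. by move=> c0 h; rewrite -(ler_pXn2r (n := 2)) ?nnegrE ?norm_ge0 // sqr_norm. Qed.

Lemma ler_ip_norm x y : Normc.normc (ip x y) <= norm x * norm y.
Proof.
have := cauchy_schwarz x y; rewrite /sqr_abs -!sqr_norm -exprMn.
by rewrite ler_pXn2r // nnegrE ?mulr_ge0 ?norm_ge0 //;
  case: (ip x y) => a b; exact: sqrtr_ge0.
Qed.

Lemma ler_Re_ip x y : Re (ip x y) <= norm x * norm y.
Proof.
apply: le_trans (ler_ip_norm x y); case: (ip x y) => a b /=.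
by rewrite (le_trans (ler_norm a)) // -sqrtr_sqr ler_wsqrtr // lerDl sqr_ge0.
Qed.

Lemma qD x y : q (x + y) = q x + q y + 2 * Re (ip x y).
Proof.
rewrite !(ipDl, ipDr) (ip_sym ipP x y).
by case: (ip x y) (ip x x) (ip y y) => [? ?] [? ?] [? ?] /=; ring.
Qed.

Lemma qZ a x : q (a *: x) = sqr_abs a * q x.
Proof. by rewrite ipZl ipZr ip_self sqr_absE; case: a => a b /=; ring. Qed.

Lemma qN x : q (- x) = q x.
Proof. by rewrite ipNl ipNr opprK. Qed.

(** By the parallelogram law the two sides differ by q(x - y). *)
Lemma qD_le x y : q (x + y) <= 2 * q x + 2 * q y.
Proof.
have := ip_ge0 ipP (x - y); rewrite !qD qN ipNr.
by case: (ip x y) => a b /=; lra.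
Qed.

Lemma normD x y : norm (x + y) <= norm x + norm y.
Proof.
apply: norm_le; first by rewrite addr_ge0 ?norm_ge0.
rewrite qD sqrrD !sqr_norm -mulr_natl; have := ler_Re_ip x y; lra.
Qed.

Lemma normN x : norm (- x) = norm x.
Proof. by rewrite /ip_norm qN. Qed.

Lemma normB_sym x y : norm (x - y) = norm (y - x).
Proof. by rewrite -opprB normN. Qed.

Lemma norm_lt e x : 0 < e -> (norm x < e) = (q x < e ^+ 2).
Proof.
by move=> e0; rewrite -sqr_norm ltr_pXn2r // nnegrE ?norm_ge0 // ltW.
Qed.

Lemma normB_le x y : norm x <= norm y + norm (x - y).
Proof. by rewrite -{1}[x](subrK y) addrC normD. Qed.

Lemma bounded_operatorW (A : {linear H -> H}) : bounded_operator ip A ->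
  exists2 M, 0 < M & forall x, norm (A x) <= M * norm x.
Proof.
move=> [M AM]; exists (`|M| + 1); first by rewrite ltr_wpDl.
move=> x; apply: le_trans (AM x) _; apply: ler_wpM2r; first exact: norm_ge0.
by rewrite (le_trans (ler_norm M)) // lerDl.
Qed.

Lemma bounded_comp (A A' : {linear H -> H}) : bounded_operator ip A ->
  bounded_operator ip A' -> bounded_operator ip (A \o A').
Proof.
move=> /bounded_operatorW[M M0 AM] /bounded_operatorW[M' M'0 AM'].
exists (M * M') => x /=; apply: le_trans (AM _) _.
by rewrite -mulrA ler_pM2l.
Qed.

Lemma bounded_add (A A' : {linear H -> H}) : bounded_operator ip A ->
  bounded_operator ip A' -> bounded_operator ip (A \+ A').
Proof.
move=> [M AM] [M' AM']; exists (M + M') => x /=.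
by apply: le_trans (normD _ _) _; rewrite mulrDl lerD.
Qed.

Lemma norm_scale a x : norm (a *: x) = Normc.normc a * norm x.
Proof.
rewrite /ip_norm qZ sqrtrM ?sqr_abs_ge0 // /sqr_abs sqrtr_sqr ger0_norm //.
by case: a => a b; exact: sqrtr_ge0.
Qed.

Lemma bounded_scale a (A : {linear H -> H}) : bounded_operator ip A ->
  bounded_operator ip (a \*: A).
Proof.
move=> [M AM]; exists (Normc.normc a * M) => x /=.
rewrite norm_scale -mulrA; apply: ler_wpM2l (AM x).
by case: a => a b; exact: sqrtr_ge0.
Qed.

(** The limit [x] is known in advance, so closedness of [M] applies directly and no Cauchy sequence
    has to be given a limit. *)
Lemma closed_subspace_geometric (M : set H) (F : nat -> H) x (rho K : R) :
  closed_subspace ip M -> (forall j, M (F j)) -> 0 <= rho < 1 ->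
  (forall j, norm (x - F j) <= rho ^+ j * K) -> M x.
Proof.
move=> [_ _ Mcl] MF /andP[rho0 rho1] hF; apply: Mcl => eps eps0.
have K0 : 0 <= K.
  by apply: le_trans (norm_ge0 _) _; have := hF 0; rewrite expr0 mul1r; apply.
have K1 : 0 < K + 1 by rewrite ltr_wpDl.
have rho_abs : `|rho| < 1 by rewrite ger0_norm.
have /cvgrPdist_lt/(_ (eps / (K + 1))) := cvg_expr rho_abs.
rewrite divr_gt0 // => /(_ isT)[j _ /(_ j (leqnn j)) /=].
rewrite sub0r normrN ger0_norm ?exprn_ge0 // => hj.
exists (F j); first exact: MF.
apply: le_lt_trans (hF j) _; apply: (@le_lt_trans _ _ (rho ^+ j * (K + 1))).
  by rewrite ler_wpM2l ?exprn_ge0 // lerDl.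
by rewrite -ltr_pdivlMr.
Qed.

Lemma closed_subspaceB (M : set H) x y :
  closed_subspace ip M -> M x -> M y -> M (x - y).
Proof. by move=> [_ ML _] Mx My; rewrite addrC -scaleN1r; apply: ML. Qed.

Lemma closed_subspaceD (M : set H) x y :
  closed_subspace ip M -> M x -> M y -> M (x + y).
Proof. by move=> [_ ML _] Mx My; rewrite -[x]scale1r; apply: ML. Qed.

Lemma closed_subspaceZ (M : set H) a x :
  closed_subspace ip M -> M x -> M (a *: x).
Proof. by move=> [M0 ML _] Mx; rewrite -[_ *: _]addr0; apply: ML. Qed.

(* [y] is the limit of the iteration [y' = y' + c N (y - y')], because [1 - c N]
   is a strict contraction for small [c]. *)
Lemma coercive_solution (M : set H) (N : {linear H -> H}) (eps L : R) y :
  closed_subspace ip M -> invariant N M -> 0 < eps <= L ->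
  (forall x, eps * Re (ip x x) <= Re (ip (N x) x)) ->
  (forall x, Re (ip (N x) (N x)) <= L ^+ 2 * Re (ip x x)) ->
  M (N y) -> M y.
Proof.
move=> Mcl NM /andP[eps0 epsL] Ngt Nle MNy.
have L0 : 0 < L by exact: lt_le_trans eps0 epsL.
(* This [c] minimizes 1 - 2 c eps + c^2 L^2, which bounds the squared norm of 1 - c N; the minimum
   is [rho2]. *)
pose c := eps / L ^+ 2.
pose F := fun j => iter j (fun z => z + c%:C *: N (y - z)) 0.
pose rho2 := 1 - (eps / L) ^+ 2.
have rho2_ge0 : 0 <= rho2.
  by rewrite subr_ge0 exprn_ile1 ?divr_ge0 ?(ltW L0) ?(ltW eps0) // ler_pdivrMr ?mul1r.
have rho2_lt1 : rho2 < 1 by rewrite gtrBl exprn_gt0 // divr_gt0.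
have contr x : norm (x - c%:C *: N x) <= Num.sqrt rho2 * norm x.
  apply: norm_le; first by rewrite mulr_ge0 ?sqrtr_ge0 ?norm_ge0.
  rewrite exprMn sqr_sqrtr // sqr_norm qD qN qZ sqr_absE /= ipNr ipZr.
  rewrite (ip_sym ipP (N x) x).
  have := Ngt x; have := Nle x.
  move: (ip (N x) (N x)) (ip x x) (ip (N x) x) => [n ?] [q ?] [p ?] /= h1 h2.
  rewrite expr0n addr0.
  have c0 : 0 < c by rewrite divr_gt0 // exprn_gt0.
  have -> : rho2 = 1 - 2 * c * eps + c ^+ 2 * L ^+ 2.
    by rewrite /rho2 /c; field; rewrite gt_eqF.
  have h3 : c ^+ 2 * n <= c ^+ 2 * (L ^+ 2 * q) by rewrite ler_wpM2l // sqr_ge0.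
  have h4 : c * (eps * q) <= c * p by rewrite ler_wpM2l // ltW.
  by lra.
apply: (closed_subspace_geometric (F := F) (rho := Num.sqrt rho2) (K := norm y)) => //.
- elim=> [|j IH]; first by case: Mcl.
  apply: closed_subspaceD => //=; apply: closed_subspaceZ => //.
  (* Only [N y] is known to lie in [M], not [y]; hence N (y - z) is split into N y - N z. *)
  by rewrite linearB; apply: closed_subspaceB => //; exact: NM.
- by rewrite sqrtr_ge0 /= -(ltr_pXn2r (n := 2)) ?nnegrE ?sqrtr_ge0 // sqr_sqrtr // expr1n.
- elim=> [|j IH]; first by rewrite subr0 expr0 mul1r.
  rewrite /= opprD addrA exprS -mulrA; apply: le_trans (contr _) _.
  by rewrite ler_wpM2l ?sqrtr_ge0.
Qed.

(** A finite combination is a list of pairs of an index and a coefficient, in which indices may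
    repeat. Totality is density of these combinations. *)
Record orthonormal_basis (e : int -> H) : Prop := OrthonormalBasis {
  onb_orthonormal : forall m n, ip (e m) (e n) = (m == n)%:R;
  onb_total : forall x eps, 0 < eps -> exists s : seq (int * C),
    norm (x - \sum_(k <- s) k.2 *: e k.1) < eps }.

(** * Bounded operators determined by their values on an orthonormal basis *)

Section Basis.
Variable e : int -> H.
Hypothesis eP : orthonormal_basis e.

Lemma ler_add_small (x y K : R) :
  (forall eps, 0 < eps -> x <= y + K * eps) -> x <= y.
Proof.
move=> h; apply/ler_addgt0Pr => eps eps0.
have K1 : 0 < `|K| + 1 by rewrite ltr_wpDl.
apply: le_trans (h (eps / (`|K| + 1)) _) _; first by rewrite divr_gt0.
rewrite lerD2l mulrCA ger_pMr // ler_pdivrMr // mul1r.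
by rewrite (le_trans (ler_norm K)) // lerDl.
Qed.

(** The operators agree on finite combinations p, so A x - A' x = A (x - p) - A' (x - p), which is
    small when p is close to x. *)
Lemma eq_on_basis (A A' : {linear H -> H}) :
  bounded_operator ip A -> bounded_operator ip A' ->
  (forall n, A (e n) = A' (e n)) -> A =1 A'.
Proof.
move=> [M AM] [M' AM'] AE x; apply/eqP; rewrite -subr_eq0; apply/eqP/norm_eq0.
apply/eqP; rewrite eq_le norm_ge0 andbT.
apply: (@ler_add_small _ _ (`|M| + `|M'|)) => eps eps0.
have [s xs] := onb_total eP x eps0; set p := \sum_(k <- s) _ in xs.
have Ap : A p = A' p.
  by rewrite !linear_sum; apply: eq_bigr => k _; rewrite !linearZ_LR /= AE.
have -> : A x - A' x = A (x - p) - A' (x - p).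
  by rewrite (linearB A) (linearB A') /= Ap opprB addrA subrK.
rewrite add0r mulrDl (le_trans (normD _ _)) // normN lerD //.
- apply: le_trans (AM _) _; apply: le_trans (ler_wpM2r (norm_ge0 _) (ler_norm M)) _.
  by rewrite ler_wpM2l // ltW.
- apply: le_trans (AM' _) _; apply: le_trans (ler_wpM2r (norm_ge0 _) (ler_norm M')) _.
  by rewrite ler_wpM2l // ltW.
Qed.

Lemma basis_orthogonal0 x : (forall n, ip x (e n) = 0) -> x = 0.
Proof.
move=> x0; apply: norm_eq0; apply/eqP; rewrite eq_le norm_ge0 andbT.
rewrite -(@ler_pXn2r _ 2) ?nnegrE ?norm_ge0 // expr0n /= sqr_norm.
apply: (@ler_add_small _ _ (norm x)) => eps eps0; rewrite add0r.
have [s xs] := onb_total eP x eps0; set p := \sum_(k <- s) _ in xs.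
have xp : ip x p = 0.
  rewrite (ip_sym ipP) ip_suml big1 ?conjc0 // => k _.
  by rewrite ipZl (ip_sym ipP) x0 conjc0 mulr0.
(* Since x is orthogonal to p, |x|^2 = <x, x - p> is at most |x| eps. *)
have -> : ip x x = ip x (x - p) by rewrite ipBr xp subr0.
by apply: le_trans (ler_Re_ip _ _) _; rewrite ler_wpM2l ?norm_ge0 // ltW.
Qed.

Lemma closed_subspace_basis (M : set H) :
  closed_subspace ip M -> (forall n, M (e n)) -> forall x, M x.
Proof.
move=> Mcl Me x; case: (Mcl) => M0 _; apply => eps /(onb_total eP x)[s xs].
exists (\sum_(k <- s) k.2 *: e k.1) => //.
by elim/big_rec: _ => // k y _ My; apply: closed_subspaceD => //; apply: closed_subspaceZ.
Qed.

Lemma adjoint_on_basis (A A' : {linear H -> H}) :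
  bounded_operator ip A -> bounded_operator ip A' ->
  (forall n m, ip (A (e n)) (e m) = ip (e n) (A' (e m))) ->
  adjoint_pair ip A A'.
Proof.
move=> /bounded_operatorW[M M0 AM] /bounded_operatorW[M' M'0 AM'] AA'.
have small (a : C) K : (forall eps, 0 < eps -> Normc.normc a <= K * eps) -> a = 0.
  move=> ha; apply: Normc.eq0_normc; apply/eqP; rewrite eq_le; apply/andP; split.
    by apply: (@ler_add_small _ _ K) => eps eps0; rewrite add0r ha.
  by case: (a) => ? ?; exact: sqrtr_ge0.
have normcB (a b : C) : Normc.normc (a - b) <= Normc.normc a + Normc.normc b.
  by rewrite (le_trans (le_normcD _ _)) // normcN.
(* The identity is extended by approximation in the second argument first, with a basis vector in
   the first; the first argument is then approximated in the same way. *)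
have AAe n y : ip (A (e n)) y = ip (e n) (A' y).
  apply/eqP; rewrite -subr_eq0; apply/eqP.
  apply: (small _ (norm (A (e n)) + norm (e n) * M')) => eps eps0.
  have [s ys] := onb_total eP y eps0; set p := \sum_(k <- s) _ in ys.
  have pE : ip (A (e n)) p = ip (e n) (A' p).
    rewrite (ip_sym ipP p) (ip_sym ipP (A' p)) /p linear_sum !ip_suml.
    congr (_^*); apply: eq_bigr => k _.
    by rewrite linearZ_LR !ipZl (ip_sym ipP) AA' -(ip_sym ipP).
  have -> : ip (A (e n)) y - ip (e n) (A' y) =
      ip (A (e n)) (y - p) - ip (e n) (A' (y - p)).
    by rewrite linearB !ipBr pE opprB addrA subrK.
  apply: le_trans (normcB _ _) _; rewrite mulrDl lerD //.
    by apply: le_trans (ler_ip_norm _ _) _; rewrite ler_wpM2l ?norm_ge0 // ltW.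
  apply: le_trans (ler_ip_norm _ _) _; rewrite -mulrA ler_wpM2l ?norm_ge0 //.
  by apply: le_trans (AM' _) _; rewrite ler_wpM2l ?ltW.
move=> x y; apply/eqP; rewrite -subr_eq0; apply/eqP.
apply: (small _ (M * norm y + norm (A' y))) => eps eps0.
have [s xs] := onb_total eP x eps0; set p := \sum_(k <- s) _ in xs.
have pE : ip (A p) y = ip p (A' y).
  rewrite linear_sum !ip_suml; apply: eq_bigr => k _.
  by rewrite linearZ_LR !ipZl AAe.
have -> : ip (A x) y - ip x (A' y) = ip (A (x - p)) y - ip (x - p) (A' y).
  by rewrite linearB !ipBl pE opprB addrA subrK.
apply: le_trans (normcB _ _) _; rewrite mulrDl lerD //.
  apply: le_trans (ler_ip_norm _ _) _; rewrite mulrAC ler_wpM2r ?norm_ge0 //.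
  by apply: le_trans (AM _) _; rewrite ler_wpM2l ?ltW.
by apply: le_trans (ler_ip_norm _ _) _; rewrite mulrC ler_wpM2l ?norm_ge0 // ltW.
Qed.

Lemma parseval (u : seq int) (c : int -> C) : uniq u ->
  q (\sum_(n <- u) c n *: e n) = \sum_(n <- u) sqr_abs (c n).
Proof.
elim: u => [|n u IH]; first by rewrite !big_nil ip0l.
move=> /= /andP[nu uu]; rewrite !big_cons qD -IH // qZ (onb_orthonormal eP) eqxx.
have -> : ip (c n *: e n) (\sum_(m <- u) c m *: e m) = 0; last by rewrite /=; ring.
rewrite (ip_sym ipP) ip_suml big1_seq ?conjc0 // => m /= mu.
rewrite ipZl ipZr (onb_orthonormal eP).
by case: eqP => [mn|]; rewrite ?mulr0 //; rewrite -mn mu in nu.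
Qed.

(** Boundedness with some constant is improved to the bound by the entries: Parseval gives it on
    finite combinations, and continuity carries it to the closure. *)
Lemma diagonal_norm (A : {linear H -> H}) (a : int -> R) (theta : R) :
  bounded_operator ip A -> (forall n, A (e n) = (a n)%:C *: e n) ->
  0 <= theta -> (forall n, `|a n| <= theta) ->
  forall x, norm (A x) <= theta * norm x.
Proof.
move=> /bounded_operatorW[M M0 AM] Ae th0 ath x.
apply: (@ler_add_small _ _ (theta + M)) => eps eps0.
have [s xs] := onb_total eP x eps0; set p := \sum_(k <- s) _ in xs.
(* Terms with equal index are collected, because [parseval] asks for distinct indices. *)
have [c pE] : exists c : int -> C, p = \sum_(n <- undup (map fst s)) c n *: e n.
  exists (fun n => \sum_(k <- s | k.1 == n) k.2).
  under eq_bigr do rewrite scaler_suml big_mkcond.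
  rewrite exchange_big /p !big_seq; apply: eq_bigr => k ks.
  rewrite (bigD1_seq k.1) ?undup_uniq ?mem_undup ?map_f //= eqxx big1 ?addr0 //.
  by move=> n; rewrite eq_sym => /negbTE ->.
have Ap : norm (A p) <= theta * norm p.
  apply: norm_le; first by rewrite mulr_ge0 ?norm_ge0.
  rewrite exprMn sqr_norm pE linear_sum.
  under eq_bigr do rewrite linearZ_LR Ae scalerA.
  rewrite !parseval ?undup_uniq // mulr_sumr ler_sum // => n _.
  have -> : sqr_abs (c n * (a n)%:C) = (a n) ^+ 2 * sqr_abs (c n).
    by rewrite !sqr_absE; case: (c n) => ? ? /=; ring.
  by rewrite ler_wpM2r ?sqr_abs_ge0 // -real_normK ?num_real // ler_pXn2r ?nnegrE.
apply: le_trans (normB_le (A x) (A p)) _; rewrite -linearB.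
have px : norm p <= norm x + eps.
  by apply: le_trans (normB_le p x) _; rewrite lerD2l normB_sym ltW.
have h1 := AM (x - p).
have h2 : M * norm (x - p) <= M * eps by rewrite ler_wpM2l ?ltW.
have h3 : theta * norm p <= theta * (norm x + eps) by rewrite ler_wpM2l.
by move: Ap h1 h2 h3; lra.
Qed.

(* Power iteration, [A] being diagonal with largest entry [1], attained only
   at [0]. *)
Lemma diagonal_iter (A : {linear H -> H}) (a : int -> R) (theta : R) :
  bounded_operator ip A -> (forall n, A (e n) = (a n)%:C *: e n) ->
  a 0 = 1 -> 0 <= theta -> (forall n, n != 0 -> `|a n| <= theta) ->
  forall x j, norm (iter j A x - ip x (e 0) *: e 0) <=
    theta ^+ j * norm (x - ip x (e 0) *: e 0).
Proof.
move=> Abd Ae a0 th0 ath x j.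
have Asym : adjoint_pair ip A A.
  apply: adjoint_on_basis => // n m; rewrite !Ae ipZl ipZr (onb_orthonormal eP).
  by rewrite conj_real; case: eqP => [->|] //; rewrite !mulr0.
have Ae0 : A (e 0) = e 0 by rewrite Ae a0 scale1r.
pose P y := ip y (e 0) *: e 0.
have PL : linear P by move=> b y z; rewrite /P (ip_linear ipP) scalerDl scalerA.
pose PM := GRing.isLinear.Build _ _ _ _ P PL.
pose P' : {linear H -> H} := HB.pack P PM.
have PP y : norm (P y) <= norm y.
  rewrite norm_scale; apply: le_trans (_ : norm y * norm (e 0) * norm (e 0) <= _).
    by rewrite ler_wpM2r ?norm_ge0 ?ler_ip_norm.
  by rewrite -mulrA -expr2 sqr_norm (onb_orthonormal eP) eqxx /= mulr1.
have Pbd : bounded_operator ip P' by exists 1 => y; rewrite mul1r; exact: PP.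
(* A minus the projection onto e_0 is diagonal with entry 0 at index 0, so its norm is at most
   [theta]. *)
pose Q : {linear H -> H} := A \+ (-1) \*: P'.
have Qbd : bounded_operator ip Q by apply: bounded_add => //; exact: bounded_scale.
have Qle y : norm (Q y) <= theta * norm y.
  apply: (diagonal_norm (a := fun n => if n == 0 then 0 else a n)) => // n.
  - rewrite /= Ae /P (onb_orthonormal eP); case: eqP => [->|_].
      by rewrite a0 !scale1r scaleN1r subrr scale0r.
    by rewrite scale0r scaler0 addr0.
  - by case: eqP => [_|/eqP /ath //]; rewrite normr0.
elim: j => [|j IH]; first by rewrite expr0 mul1r.
rewrite exprS -mulrA.
apply: le_trans (_ : _ <= theta * norm (iter j A x - P x)) _; last first.
  by rewrite ler_wpM2l.
have iterP : ip (iter j A x) (e 0) = ip x (e 0).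
  by elim: j {IH} => //= j IH; rewrite Asym Ae0.
(* The error has no component along e_0, since A is symmetric and fixes e_0; on such vectors A and Q
   agree. *)
have -> : iter j.+1 A x - ip x (e 0) *: e 0 = Q (iter j A x - P x).
  have -> : Q (iter j A x - P x) = A (iter j A x - P x) - P (iter j A x - P x).
    by rewrite /= scaleN1r.
  rewrite (linearB A) /P ipBl ipZl (onb_orthonormal eP) eqxx mulr1 iterP subrr.
  by rewrite scale0r subr0 (linearZ_LR A) /= Ae0.
exact: Qle.
Qed.

End Basis.
End InnerProductTheory.

(** * Block operators *)

Section Block.
Variables (R : realType) (H : lmodType R[i]) (ip : H -> H -> R[i]).
Hypothesis ipP : inner_product ip.
Local Notation C := R[i].

Lemma sum_ip_inner_product : inner_product (sum_ip ip).
Proof.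
split.
- by move=> a x y z; rewrite /sum_ip /= !(ip_linear ipP) mulrDr addrACA.
- by move=> x y; rewrite /sum_ip (ip_sym ipP) (ip_sym ipP x.2) -rmorphD.
- move=> x; rewrite /sum_ip; have := ip_ge0 ipP x.1; have := ip_ge0 ipP x.2.
  by case: (ip x.1 x.1) (ip x.2 x.2) => ? ? [? ?] /=; exact: (fun a b => addr_ge0 b a).
- move=> [x1 x2]; rewrite /sum_ip /= => h.
  have := ip_ge0 ipP x1; have := ip_ge0 ipP x2.
  have := @ip_eq0 _ _ _ ipP x1; have := @ip_eq0 _ _ _ ipP x2; move: h.
  by case: (ip x1 x1) (ip x2 x2) => r1 i1 [r2 i2] /= h e2 e1 *; rewrite e1 ?e2 //; lra.
Qed.

Lemma norm_sum_ip x : ip_norm (sum_ip ip) x <= ip_norm ip x.1 + ip_norm ip x.2.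
Proof.
apply: norm_le; first exact: sum_ip_inner_product.
  by rewrite addr_ge0 ?norm_ge0.
have -> : Re (sum_ip ip x x) = Re (ip x.1 x.1) + Re (ip x.2 x.2).
  by rewrite /sum_ip; case: (ip _ _) (ip x.2 _) => ? ? [].
rewrite sqrrD !sqr_norm // lerD2r lerDl mulrn_wge0 // mulr_ge0 ?norm_ge0 //.
Qed.

(** [U] is the bilateral shift, [W] its inverse and adjoint, and [D] a diagonal operator with
    entries [d n]. In [d_max] a uniform gap [theta] is demanded rather than a strict maximum at 0,
    so that the power iteration converges geometrically. *)
Variables (e : int -> H) (U W D : {linear H -> H}) (d : int -> R) (a theta : R).
Hypothesis eP : orthonormal_basis ip e.
Hypothesis Ubd : bounded_operator ip U.
Hypothesis Wbd : bounded_operator ip W.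
Hypothesis Dbd : bounded_operator ip D.
Hypothesis UK : cancel U W.
Hypothesis WK : cancel W U.
Hypothesis UW : adjoint_pair ip U W.
Hypothesis DD : adjoint_pair ip D D.
Hypothesis Ue : forall n, U (e n) = e (n + 1).
Hypothesis De : forall n, D (e n) = (d n)%:C *: e n.
Hypothesis a_neq0 : a != 0.
Hypothesis d_neq0 : forall n, d n != 0.
Hypothesis d01_neq0 : d 0 + d 1 != 0.
Hypothesis theta01 : 0 <= theta < 1.
Hypothesis d_max : forall n : int, n != 0 ->
  d n ^+ 2 + d (n - 1) ^+ 2 <= theta * (d 0 ^+ 2 + d (- 1) ^+ 2).
Variable T : {linear (H * H)%type -> (H * H)%type}.
Hypothesis TE : forall x, T x = (U (x.1 + a%:C *: D x.2), U x.2).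

Local Notation q x := (Re (ip x x)).
Local Notation q2 x := (Re (sum_ip ip x x)).
Local Notation ip2P := sum_ip_inner_product.
Local Notation aC := (a%:C : C).

Lemma We n : W (e n) = e (n - 1).
Proof. by rewrite -{1}[n](subrK 1) -Ue UK. Qed.

Definition block_adjoint (x : H * H) : H * H :=
  (W x.1, aC *: D (W x.1) + W x.2).

Lemma block_adjoint_linear : linear block_adjoint.
Proof.
move=> b [x1 x2] [y1 y2]; rewrite /block_adjoint /=; congr pair; first by rewrite linearP.
by rewrite !linearP /= !scalerDr !scalerA (mulrC b) addrACA.
Qed.

HB.instance Definition _ := GRing.isLinear.Build C (H * H)%type (H * H)%type
  *:%R block_adjoint block_adjoint_linear.

(** [reducing] quantifies over all adjoints of [T]; exhibiting one turns this into invariance of [M]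
    under a concrete operator. *)
Lemma block_adjointP : adjoint_pair (sum_ip ip) T block_adjoint.
Proof.
move=> x y; rewrite TE /sum_ip /= !UW (ipDl ipP) (ipZl ipP) (ipDr ipP) (ipZr ipP) DD.
by rewrite conj_real addrA.
Qed.

Variable M : set (H * H)%type.
Hypothesis M_reducing : reducing (sum_ip ip) T M.

Let Mcl : closed_subspace (sum_ip ip) M. Proof. by case: M_reducing. Qed.
Let MT : invariant T M. Proof. by case: M_reducing. Qed.
Let MT' : invariant block_adjoint M.
Proof. by case: M_reducing => _ _ /(_ block_adjoint); apply; exact: block_adjointP. Qed.

Let gram : {linear (H * H)%type -> (H * H)%type} := block_adjoint \o T.
(** [gram] is the product of the triangular matrices [1, 0; a D, 1] and [1, a D; 0, 1]; [gram_inv]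
    is the product of their inverses in the opposite order. *)
Definition gram_inv (x : H * H) : H * H :=
  (x.1 + aC *: D (aC *: D x.1) - aC *: D x.2, x.2 - aC *: D x.1).

Lemma gramE x :
  gram x = (x.1 + aC *: D x.2, aC *: D (x.1 + aC *: D x.2) + x.2).
Proof. by rewrite /gram /= TE /block_adjoint /= !UK. Qed.

Lemma gram_invK x : gram (gram_inv x) = x.
Proof.
case: x => x1 x2; rewrite gramE /gram_inv /=.
have -> : x1 + aC *: D (aC *: D x1) - aC *: D x2 + aC *: D (x2 - aC *: D x1) = x1.
  by rewrite [D (x2 - _)]linearB scalerBr addrA subrK addrK.
by rewrite addrC subrK.
Qed.

Lemma qU x : q (U x) = q x. Proof. by rewrite UW UK. Qed.

Lemma qW x : q (W x) = q x. Proof. by rewrite -UW WK. Qed.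

Lemma q2E x : q2 x = q x.1 + q x.2.
Proof. by rewrite /sum_ip; case: (ip x.1 _) (ip x.2 _) => ? ? []. Qed.

(** [T] is bounded below, so [gram] is coercive, and [coercive_solution] recovers [gram_inv x]
    inside [M] from its image [x]. *)
Lemma reducing_gram_inv x : M x -> M (gram_inv x).
Proof.
have [m m0 Dle] : exists2 m, 0 < m & forall x, q (aC *: D x) <= m * q x.
  have [m m0 Dm] := bounded_operatorW (bounded_scale ipP aC Dbd).
  exists (m ^+ 2); first by rewrite exprn_gt0.
  move=> y; rewrite -!(sqr_norm ipP) -exprMn.
  by rewrite ler_pXn2r ?nnegrE ?mulr_ge0 ?norm_ge0 ?(ltW m0) //; exact: Dm.
have q0 z := ip_ge0 ipP z.
(* One constant serves for the upper bounds on [T] and its adjoint and for the lower bound on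
   [T]. *)
pose K := 2 * m + 2; have K0 : 0 < K by rewrite /K; lra.
have T_le z : q2 (T z) <= K * q2 z.
  rewrite TE !q2E /= !qU; have := qD_le ipP z.1 (aC *: D z.2).
  have := Dle z.2; have := q0 z.1; have := q0 z.2; rewrite /K.
  move: (q z.1) (q z.2) (q (aC *: D z.2)) (q (_ + _)) => y1 y2 s t ? ? ? ?.
  have : 0 <= m * y1 by rewrite mulr_ge0 // ltW.
  by lra.
have T'_le z : q2 (block_adjoint z) <= K * q2 z.
  rewrite /block_adjoint !q2E /= !qW; have := qD_le ipP (aC *: D (W z.1)) (W z.2).
  have := Dle (W z.1); have := q0 z.1; have := q0 z.2; rewrite !qW /K.
  move: (q z.1) (q z.2) (q (aC *: D _)) (q (_ + _)) => y1 y2 s t ? ? ? ?.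
  have : 0 <= m * y2 by rewrite mulr_ge0 // ltW.
  by lra.
(* The first component is recovered by writing z.1 as (z.1 + a D z.2) - a D z.2. *)
have T_ge z : q2 z <= K * q2 (T z).
  rewrite TE !q2E /= !qU; have := qD_le ipP (z.1 + aC *: D z.2) (- (aC *: D z.2)).
  rewrite addrK (qN ipP) /K.
  have := Dle z.2; have := q0 (z.1 + aC *: D z.2); have := q0 z.2.
  move: (q z.1) (q z.2) (q (aC *: D z.2)) (q (_ + _)) => y1 y2 s t ? ? ? ?.
  have : 0 <= m * t by rewrite mulr_ge0 // ltW.
  by lra.
move=> Mx; apply: (@coercive_solution _ _ _ ip2P M gram K^-1 K) => //.
- by move=> y My; apply: MT'; exact: MT.
- by rewrite invr_gt0 K0 /= (le_trans (y := 1)) ?invf_le1 /K //; lra.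
- move=> y; have -> : Re (sum_ip ip (gram y) y) = q2 (T y).
    rewrite [LHS](_ : _ = Re (sum_ip ip (block_adjoint (T y)) y)) //.
    by rewrite (ip_sym ip2P) -block_adjointP; case: (sum_ip _ _ _).
  by rewrite ler_pdivrMl.
- move=> y; apply: le_trans (T'_le _) _.
  by rewrite expr2 -mulrA ler_pM2l.
- by rewrite gram_invK.
Qed.

(** The vector x - [gram_inv] x is (a D x.2 - a^2 D^2 x.1, a D x.1); applying [T] cancels the term
    with D^2, and only a swap of the summands remains. *)
Lemma reducing_cross x : M x -> M (aC *: U (D x.2), aC *: U (D x.1)).
Proof.
move=> Mx; have := MT (closed_subspaceB Mcl Mx (reducing_gram_inv Mx)).
rewrite TE /=; set y2 := aC *: D x.1.
have -> : x.2 - (x.2 - y2) = y2 by rewrite opprB addrC subrK.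
have -> : x.1 - (x.1 + aC *: D y2 - aC *: D x.2) + aC *: D y2 = aC *: D x.2.
  by rewrite opprB addrCA opprD addNKr subrK.
by rewrite /y2 !(linearZ_LR U).
Qed.

Lemma reducing_cross' x : M x -> M (aC *: D (W x.2), aC *: D (W x.1)).
Proof.
move=> Mx; have My := MT' Mx.
have := closed_subspaceB Mcl My (reducing_gram_inv My).
congr M; congr pair => /=; last by rewrite opprB addrC subrK.
by rewrite (linearD D) scalerDr opprB addrCA opprD addNKr addrAC subrr add0r.
Qed.

(** Conjugation by the shift moves the entries of D^2 by one index, so the entry of [G] at n is
    d_n^2 + d_{n-1}^2. *)
Let G : {linear H -> H} := (D \o D) \+ (U \o D \o D \o W).

Lemma reducing_diag x : M x -> M (G x.1, G x.2).
Proof.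
move=> Mx.
have := closed_subspaceD Mcl (reducing_cross' (reducing_cross Mx))
  (reducing_cross (reducing_cross' Mx)).
move=> /(closed_subspaceZ ((aC * aC)^-1) Mcl); congr M.
have aC0 : aC * aC != 0 by rewrite mulf_neq0 // (inj_eq (@complexI _)).
congr pair => /=; rewrite !(linearZ_LR W, linearZ_LR D, linearZ_LR U) /= !UK;
  by rewrite !scalerA -scalerDr scalerA mulVf ?scale1r.
Qed.

Local Notation h0 := (d 0 ^+ 2 + d (- 1) ^+ 2).

Lemma h0_gt0 : 0 < h0.
Proof. by rewrite addr_gt0 // exprn_even_gt0 ?d_neq0. Qed.

Lemma reducing_proj x : M x -> M (ip x.1 (e 0) *: e 0, ip x.2 (e 0) *: e 0).
Proof.
move=> Mx.
(* Division by the largest entry turns the entry at 0 into 1, so the powers of [g] converge to the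
   projection onto e_0. *)
pose g : {linear H -> H} := (h0^-1)%:C \*: G.
have gbd : bounded_operator ip g.
  apply: (bounded_scale ipP); apply: (bounded_add ipP); first exact: bounded_comp.
  by do 3 (apply: bounded_comp => //).
have ge n : g (e n) = ((d n ^+ 2 + d (n - 1) ^+ 2) / h0)%:C *: e n.
  rewrite /= We !De !(linearZ_LR D) /= !De !scalerA.
  rewrite (linearZ_LR U) /= Ue subrK -scalerDl scalerA.
  by rewrite -!rmorphM -rmorphD -rmorphM -!expr2 mulrC.
have g0 : (d 0 ^+ 2 + d (0 - 1) ^+ 2) / h0 = 1.
  by rewrite add0r divff // gt_eqF // h0_gt0.
have gle n : n != 0 -> `|(d n ^+ 2 + d (n - 1) ^+ 2) / h0| <= theta.
  move=> n0; rewrite ger0_norm ?divr_ge0 ?addr_ge0 ?sqr_ge0 //.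
  by rewrite ler_pdivrMr ?h0_gt0 // d_max.
have [th0 th1] := andP theta01.
have iterE := diagonal_iter ipP eP gbd ge g0 th0 gle.
apply: (closed_subspace_geometric (F := fun j => (iter j g x.1, iter j g x.2))
  (rho := theta) (K := ip_norm ip (x.1 - ip x.1 (e 0) *: e 0) +
                       ip_norm ip (x.2 - ip x.2 (e 0) *: e 0)) Mcl) => //.
- elim=> [|j IH]; first by move: Mx; rewrite {1}(surjective_pairing x).
  exact: (closed_subspaceZ (h0^-1)%:C Mcl (reducing_diag IH)).
- move=> j; apply: le_trans (norm_sum_ip _) _; rewrite mulrDr /=.
  by apply: lerD; rewrite (normB_sym ipP); exact: iterE.
Qed.

Local Notation E n u v := ((u *: e n, v *: e n) : (H * H)%type).

(** On multiples of e_n the cross operator is the nonzero scalar a d_n times a swap and a shift of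
    the index; the scalar is divided out. *)
Lemma reducing_cross_basis n u v : M (E n u v) -> M (E (n + 1) v u).
Proof.
move=> /reducing_cross /= /(closed_subspaceZ (aC * (d n)%:C)^-1 Mcl).
have ad0 : aC * (d n)%:C != 0 by rewrite mulf_neq0 // (inj_eq (@complexI _)).
congr M; rewrite !(linearZ_LR D) /= !De !(linearZ_LR U) /= !Ue.
congr pair; rewrite /= !scalerA; congr (_ *: _);
  by apply: (mulfI ad0); rewrite !mulrA divff // mul1r; ring.
Qed.

Lemma reducing_cross_basis' n u v : M (E n u v) -> M (E (n - 1) v u).
Proof.
(* Here [W] acts before [D], which explains the weight at n - 1. *)
move=> /reducing_cross' /= /(closed_subspaceZ (aC * (d (n - 1))%:C)^-1 Mcl).
have ad0 : aC * (d (n - 1))%:C != 0 by rewrite mulf_neq0 // (inj_eq (@complexI _)).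
congr M; rewrite !(linearZ_LR W) /= !We !(linearZ_LR D) /= !De.
congr pair; rewrite /= !scalerA; congr (_ *: _);
  by apply: (mulfI ad0); rewrite !mulrA divff // mul1r; ring.
Qed.

Lemma reducing_T_basis n u v : M (E n u v) -> M (E (n + 1) (u + aC * (d n)%:C * v) v).
Proof.
move=> /MT; congr M; rewrite TE /= (linearZ_LR D) De !scalerA -scalerDl.
by rewrite !(linearZ_LR U) /= Ue; congr pair; congr (_ *: _); ring.
Qed.

(* [T] twice and then the adjoint cross operator twice act on [E 0] as a
   multiple of [[1, s; 0, 1]], with [s = a (d 0 + d 1)]. *)
Lemma reducing_basis0_right u v : M (E 0 u v) -> v != 0 -> M (E 0 1 0).
Proof.
move=> Muv v0.
have /reducing_T_basis /reducing_cross_basis' /reducing_cross_basis' := reducing_T_basis Muv.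
move=> /(closed_subspaceB Mcl)/(_ Muv).
(* In contrast to the factor in the matrix, this [s] includes the coordinate [v]. *)
set s := aC * (d 0 + d 1)%:C * v.
have s0 : s != 0 by rewrite !mulf_neq0 // (inj_eq (@complexI _)).
move=> /(closed_subspaceZ s^-1 Mcl); congr M; rewrite !addrK.
congr pair; rewrite /= -scalerBl scalerA; congr (_ *: _); last by rewrite subrr mulr0.
by apply: (mulfI s0); rewrite mulrA divff // mul1r mulr1 /s rmorphD; ring.
Qed.

Lemma reducing_basis0 u v : M (E 0 u v) -> (u != 0) || (v != 0) ->
  M (E 0 1 0) /\ M (E 0 0 1).
Proof.
move=> Muv uv0.
have M10 : M (E 0 1 0).
  have [v0|] := eqVneq v 0; last exact: reducing_basis0_right Muv.
  move: uv0 Muv; rewrite v0 eqxx orbF => u0 /(closed_subspaceZ u^-1 Mcl).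
  by congr M; congr pair; rewrite /= scalerA ?mulr0 ?mulVf.
(* [T] sends (e_0, 0) to (e_1, 0), and the adjoint cross operator brings this to a multiple of (0,
   e_0). *)
split => //; have := reducing_cross_basis' (reducing_T_basis M10).
by rewrite mulr0 addr0 addrK.
Qed.

Lemma reducing_full : M (E 0 1 0) -> M (E 0 0 1) -> M = setT.
Proof.
move=> M10 M01.
(* The cross operators exchange the summands, so both memberships are carried through the induction
   together. *)
have ME n : M (E n 1 0) /\ M (E n 0 1).
  elim: n => [//|n [h1 h2]|n [h1 h2]].
    rewrite -addn1 PoszD; split; exact: reducing_cross_basis.
  rewrite -addn1 PoszD opprD; split; exact: reducing_cross_basis'.
(* Preimages of [M] under linear contractions are closed subspaces; this is applied to the two
   embeddings of H. *)
have cl (f : {linear H -> (H * H)%type}) :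
    (forall x, ip_norm (sum_ip ip) (f x) <= ip_norm ip x) ->
    closed_subspace ip (fun x => M (f x)).
  case: (Mcl) => M0 ML Mc fle; split => [|b x y|x hx]; first by rewrite linear0.
    by rewrite linearP; exact: ML.
  apply: Mc => eps /hx[y My xy]; exists (f y) => //.
  by rewrite -linearB; apply: le_lt_trans (fle _) xy.
have f1L : linear (fun x : H => (x, 0) : (H * H)%type).
  by move=> b x y; congr pair; rewrite /= scaler0 addr0.
have f2L : linear (fun x : H => (0, x) : (H * H)%type).
  by move=> b x y; congr pair; rewrite /= scaler0 addr0.
pose f1M := GRing.isLinear.Build _ _ _ _ _ f1L.
pose f2M := GRing.isLinear.Build _ _ _ _ _ f2L.
pose f1 : {linear H -> (H * H)%type} := HB.pack (fun x : H => (x, 0) : (H * H)%type) f1M.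
pose f2 : {linear H -> (H * H)%type} := HB.pack (fun x : H => (0, x) : (H * H)%type) f2M.
have n0 : ip_norm ip 0 = 0 by rewrite /ip_norm (ip0l ipP) sqrtr0.
have M1 x : M (f1 x).
  apply: (closed_subspace_basis eP (cl f1 _)) => [y|n].
    by apply: le_trans (norm_sum_ip _) _; rewrite /= n0 addr0.
  by have [] := ME n; rewrite scale1r scale0r.
have M2 x : M (f2 x).
  apply: (closed_subspace_basis eP (cl f2 _)) => [y|n].
    by apply: le_trans (norm_sum_ip _) _; rewrite /= n0 add0r.
  by have [] := ME n; rewrite scale1r scale0r.
apply/seteqP; split => // -[x y] _.
have := closed_subspaceD Mcl (M1 x) (M2 y).
by congr M; congr pair; rewrite /= ?addr0 ?add0r.
Qed.

Lemma WU x y : ip (W x) y = ip x (U y).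
Proof. by rewrite -{2}[x]WK UW UK. Qed.

(** The coordinates at n of the two cross operators are nonzero multiples of the coordinates of the
    vector at n - 1 and n + 1. Vanishing at index 0 throughout [M] therefore spreads to every
    index. *)
Lemma reducing_trivial : (forall x, M x -> ip x.1 (e 0) = 0 /\ ip x.2 (e 0) = 0) ->
  M = [set 0]%classic.
Proof.
move=> M0.
have ad0 n : aC * (d n)%:C != 0 by rewrite mulf_neq0 // (inj_eq (@complexI _)).
have up y n : ip (aC *: D (W y)) (e n) = 0 -> ip y (e (n + 1)) = 0.
  rewrite (ipZl ipP) DD De (ipZr ipP) conj_real WU Ue mulrA => /eqP.
  by rewrite mulf_eq0 (negbTE (ad0 n)) => /eqP.
have down y n : ip (aC *: U (D y)) (e n) = 0 -> ip y (e (n - 1)) = 0.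
  rewrite (ipZl ipP) UW DD We De (ipZr ipP) conj_real mulrA => /eqP.
  by rewrite mulf_eq0 (negbTE (ad0 (n - 1))) => /eqP.
have Mn n : forall x, M x -> ip x.1 (e n) = 0 /\ ip x.2 (e n) = 0.
  elim: n => [//|n IH|n IH] x Mx; rewrite -addn1 PoszD ?opprD.
    by have [/= /up h2 /up h1] := IH _ (reducing_cross' Mx).
  by have [/= /down h2 /down h1] := IH _ (reducing_cross Mx).
apply/seteqP; split => [[x y] Mxy|_ ->]; last by case: Mcl.
by congr pair; apply: (basis_orthogonal0 ipP eP) => n; have [] := Mn n _ Mxy.
Qed.

Theorem block_irreducible : M = [set 0]%classic \/ M = setT.
Proof.
have [M0|] := pselect (forall x, M x -> ip x.1 (e 0) = 0 /\ ip x.2 (e 0) = 0).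
  by left; exact: reducing_trivial.
move=> /existsNP[x /not_implyP[Mx hx]]; right.
have [] := reducing_basis0 (reducing_proj Mx); last exact: reducing_full.
rewrite -negb_and; apply/negP => /andP[/eqP ? /eqP ?]; exact: hx.
Qed.
End Block.

(** * The Hilbert space structure of L2 *)

#[local] Instance circle_ae_filter (R : realType) :
  Filter (almost_everywhere (circle_meas R)).
Proof. exact: ae_filter_ringOfSetsType. Qed.

Section L2InnerProduct.
Variable R : realType.
Local Notation C := R[i].
Local Notation mu := (circle_meas R).
Local Notation L2R := (L2 R).
Implicit Types (x y z : L2 R) (f g : R -> C).

Definition complex_measurable f : Prop :=
  measurable_fun setT (fun t => Re (f t)) /\
  measurable_fun setT (fun t => Im (f t)).

Lemma sq_integrable_measurable f : sq_integrable f -> complex_measurable f.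
Proof. by case. Qed.

Lemma L2rep_sq_integrable x : sq_integrable (L2rep x).
Proof. by rewrite /L2rep; case: (repr x) => f /= /asboolP. Qed.

Lemma L2rep_pi (f : L2fun R) : {ae mu, forall t, L2rep (\pi_L2R f) t = f t}.
Proof.
have : repr (\pi_L2R f) - f \in @L2null R.
  by rewrite Quotient.idealrBE reprK.
move=> /asboolP; apply: filterS => t /= h; apply/eqP; rewrite -subr_eq0; apply/eqP.
exact: h.
Qed.

Lemma L2_pi0 : \pi_L2R 0 = 0.
Proof. by apply: (addrI (\pi_L2R 0)); rewrite L2_pi_add !addr0. Qed.

Lemma L2rep_linear a x y :
  {ae mu, forall t, L2rep (a *: x + y) t = a * L2rep x t + L2rep y t}.
Proof.
have -> : a *: x + y = \pi_L2R (a *: repr x + repr y).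
  by rewrite -L2_pi_add -L2scale_pi !reprK.
exact: L2rep_pi.
Qed.

Lemma L2_eq_ae x y : {ae mu, forall t, L2rep x t = L2rep y t} -> x = y.
Proof.
move=> xy; rewrite -[x]reprK -[y]reprK; apply/eqP; rewrite -Quotient.idealrBE.
apply/asboolP; move: xy; apply: filterS => t /= h.
by rewrite -[LHS]/(L2rep x t - L2rep y t) h subrr.
Qed.

Lemma complex_measurable_conjM f g : complex_measurable f ->
  complex_measurable g -> complex_measurable (fun t => f t * (g t)^*).
Proof.
move=> [fr fi] [gr gi]; split.
  rewrite [X in measurable_fun _ X](_ : _ =
    fun t => Re (f t) * Re (g t) + Im (f t) * Im (g t)).
    by apply: measurable_funD; apply: measurable_funM.
  by apply/funext => t; case: (f t) (g t) => ? ? [? ?] /=; ring.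
rewrite [X in measurable_fun _ X](_ : _ =
    fun t => Im (f t) * Re (g t) - Re (f t) * Im (g t)).
  by apply: measurable_funB; apply: measurable_funM.
by apply/funext => t; case: (f t) (g t) => ? ? [? ?] /=; ring.
Qed.

Lemma sqr_abs_integrable f : sq_integrable f ->
  mu.-integrable setT (EFin \o (fun t => sqr_abs (f t))).
Proof.
move=> [fr fi fI]; apply/integrableP; split; first exact: measurable_sqr_abs.
under eq_integral do rewrite /= ger0_norm ?sqr_abs_ge0 //.
exact: fI.
Qed.

(** Both parts of the product are dominated by |f|^2 + |g|^2. *)
Lemma conjM_integrable f g : sq_integrable f -> sq_integrable g ->
  mu.-integrable setT (EFin \o (fun t => Re (f t * (g t)^*))) /\
  mu.-integrable setT (EFin \o (fun t => Im (f t * (g t)^*))).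
Proof.
move=> fI gI.
have [mr mi] := complex_measurable_conjM (sq_integrable_measurable fI)
  (sq_integrable_measurable gI).
have S := integrableD measurableT (sqr_abs_integrable fI) (sqr_abs_integrable gI).
split; apply: (le_integrable measurableT _ _ S);
  try exact/measurable_EFinP; move=> t _ /=; rewrite lee_fin;
  rewrite [leRHS]ger0_norm ?addr_ge0 ?sqr_abs_ge0 // !sqr_absE ler_norml;
  case: (f t) (g t) => a b [c d] /=; apply/andP; split;
  have := sqr_ge0 (a - c); have := sqr_ge0 (a + c);
  have := sqr_ge0 (b - d); have := sqr_ge0 (b + d);
  have := sqr_ge0 (b - c); have := sqr_ge0 (b + c);
  have := sqr_ge0 (a - d); have := sqr_ge0 (a + d); nra.
Qed.

Lemma Rintegral_ae (f g : R -> R) :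
  measurable_fun setT f -> measurable_fun setT g ->
  {ae mu, forall t, f t = g t} -> \int[mu]_t f t = \int[mu]_t g t.
Proof.
move=> mf mg fg; congr fine; apply: ae_eq_integral => //.
- exact/measurable_EFinP.
- exact/measurable_EFinP.
- by move: fg; apply: filterS => t /= -> _.
Qed.

Lemma L2ip_ae x y f g : sq_integrable f -> sq_integrable g ->
  {ae mu, forall t, L2rep x t = f t} -> {ae mu, forall t, L2rep y t = g t} ->
  L2ip x y = (\int[mu]_t Re (f t * (g t)^*)) +i* (\int[mu]_t Im (f t * (g t)^*)).
Proof.
move=> fI gI xf yg.
have [mr mi] := complex_measurable_conjM (sq_integrable_measurable fI)
  (sq_integrable_measurable gI).
have [nr ni] := complex_measurable_conjM
  (sq_integrable_measurable (L2rep_sq_integrable x))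
  (sq_integrable_measurable (L2rep_sq_integrable y)).
by congr (_ +i* _); apply: Rintegral_ae => //; move: xf yg;
  apply: filterS2 => t /= -> ->.
Qed.

Lemma sq_integrable_linear a f g : sq_integrable f -> sq_integrable g ->
  sq_integrable (fun t => a * f t + g t).
Proof.
move=> /asboolP fI /asboolP gI; apply/asboolP.
by have [_] := L2pred_submod_closed R; apply.
Qed.

Lemma L2ip_inner_product : inner_product (@L2ip R).
Proof.
split.
- move=> a x y z.
  have xI := L2rep_sq_integrable x; have yI := L2rep_sq_integrable y.
  have zI := L2rep_sq_integrable z.
  have zz : {ae mu, forall t, L2rep z t = L2rep z t} by exact: aeW.
  rewrite (L2ip_ae (sq_integrable_linear a xI yI) zI (L2rep_linear a x y) zz).
  have [xr xi] := conjM_integrable xI zI; have [yr yi] := conjM_integrable yI zI.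
  have iZ (c : R) (h : R -> R) : mu.-integrable setT (EFin \o h) ->
      mu.-integrable setT (EFin \o (fun t => c * h t)).
    by move=> hI; apply: (integrableZl measurableT c hI).
  rewrite /L2ip; apply/eqP; rewrite eq_complex /=; apply/andP; split; apply/eqP.
  + rewrite (_ : \int[mu]_t _ = \int[mu]_t (Re a * Re (L2rep x t * (L2rep z t)^*) +
      (- Im a * Im (L2rep x t * (L2rep z t)^*) + Re (L2rep y t * (L2rep z t)^*)))).
      rewrite !RintegralD ?RintegralZl //; try (by apply: iZ).
        by case: (a) => ? ? /=; ring.
      by apply: (integrableD measurableT (iZ _ _ xi) yr).
    apply: eq_Rintegral => t _.
    by case: (a) (L2rep x t) (L2rep y t) (L2rep z t) => ? ? [? ?] [? ?] [? ?] /=; ring.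
  + rewrite (_ : \int[mu]_t _ = \int[mu]_t (Re a * Im (L2rep x t * (L2rep z t)^*) +
      (Im a * Re (L2rep x t * (L2rep z t)^*) + Im (L2rep y t * (L2rep z t)^*)))).
      rewrite !RintegralD ?RintegralZl //; try (by apply: iZ).
        by case: (a) => ? ? /=; ring.
      by apply: (integrableD measurableT (iZ _ _ xr) yi).
    apply: eq_Rintegral => t _.
    by case: (a) (L2rep x t) (L2rep y t) (L2rep z t) => ? ? [? ?] [? ?] [? ?] /=; ring.
- move=> x y; rewrite /L2ip; apply/eqP; rewrite eq_complex /=; apply/andP; split; apply/eqP.
    apply: eq_Rintegral => t _.
    by case: (L2rep x t) (L2rep y t) => ? ? [? ?] /=; ring.
  have [_ xi] := conjM_integrable (L2rep_sq_integrable x) (L2rep_sq_integrable y).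
  rewrite -mulN1r -RintegralZl //; apply: eq_Rintegral => t _.
  by case: (L2rep x t) (L2rep y t) => ? ? [? ?] /=; ring.
- move=> x; apply: Rintegral_ge0 => t _.
  by case: (L2rep x t) => a b /=; rewrite mulrN opprK -!expr2 addr_ge0 ?sqr_ge0.
- move=> x /= x0; apply: L2_eq_ae.
  have [xI x2I] := (L2rep_sq_integrable x, sqr_abs_integrable (L2rep_sq_integrable x)).
  (* Definiteness: a nonnegative function with integral zero vanishes almost everywhere. *)
  have i0 : (\int[mu]_t `|(EFin \o (fun t => sqr_abs (L2rep x t))) t| = 0)%E.
    have -> : (\int[mu]_t `|(EFin \o (fun t => sqr_abs (L2rep x t))) t| =
       \int[mu]_t (sqr_abs (L2rep x t))%:E)%E.
      by apply: eq_integral => t _; rewrite /= ger0_norm ?sqr_abs_ge0.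
    rewrite -[LHS]fineK ?(integrable_fin_num measurableT x2I) //; congr EFin.
    rewrite -[RHS]x0; apply: eq_Rintegral => t _.
    by rewrite sqr_absE; case: (L2rep x t) => a b /=; ring.
  have [mr mi _] := xI.
  have [/(_ i0) + _] := ae_eq_integral_abs mu measurableT (measurable_sqr_abs mr mi).
  (* The representative chosen for the zero class is only known to vanish almost everywhere. *)
  have h0 : {ae mu, forall t, L2rep (0 : L2 R) t = 0}.
    by rewrite -L2_pi0; exact: L2rep_pi (0 : L2fun R).
  move: h0; apply: filterS2 => t /= -> /(_ I) [].
  by move=> h; apply: Normc.eq0_normc; apply/eqP; rewrite -sqrf_eq0; apply/eqP.
Qed.

End L2InnerProduct.

(** * Orthonormality of the monomials, and multiplication by conj z *)

Section CircleMonomials.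
Variable R : realType.
Local Notation C := R[i].
Local Notation mu := (circle_meas R).
Local Notation L2R := (L2 R).
Implicit Types (x y z : L2 R) (f g : R -> C).

Lemma integral_circle_FTC (f F : R -> R) : continuous f ->
  (forall t, 0 <= f t) -> (forall t : R, is_derive t 1 F (f t)) ->
  (\int[mu]_t (f t)%:E)%E = ((F (2 * pi) - F 0) / (2 * pi))%:E.
Proof.
move=> fc f0 dF.
rewrite integral_uniform; last 2 first.
- by apply/measurable_EFinP; apply: continuous_measurable_fun.
- by move=> t; rewrite lee_fin f0.
have Fc : continuous F.
  move=> t; apply: differentiable_continuous; apply/derivable1_diffP.
  by have [] := dF t.
rewrite (@continuous_FTC2 _ f F) ?twopi_gt0 //.
- by rewrite subr0 -EFinB -EFinM mulrC.
- exact: continuous_subspaceT.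
- split; first by move=> t _; have [] := dF t.
  + by apply: cvg_at_right_filter; exact: Fc.
  + by apply: cvg_at_left_filter; exact: Fc.
- by move=> t _; rewrite derive1E; have [_ ->] := dF t.
Qed.

(** The integral formula above is for nonnegative functions, so it is applied to 1 + f, with
    primitive t + F t. *)
Lemma Rintegral_circle_trig (f F : R -> R) : continuous f ->
  (forall t, -1 <= f t <= 1) -> (forall t : R, is_derive t 1 F (f t)) ->
  F (2 * pi) = F 0 -> \int[mu]_t f t = 0.
Proof.
move=> fc f1 dF F0.
have mf : measurable_fun setT f by exact: continuous_measurable_fun.
have fI : mu.-integrable setT (EFin \o f).
  apply: measurable_bounded_integrable => //.
    by rewrite (le_lt_trans (probability_le1 mu measurableT)) ?ltry.
  exists 1; split; first exact: num_real.
  move=> M M1 t _ /=; apply: le_trans (ltW M1).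
  by rewrite ler_norml f1.
have cI : mu.-integrable setT (EFin \o (fun=> 1 : R)) by exact: finite_measure_integrable_cst.
have : \int[mu]_t (1 + f t) = 1.
  rewrite /Rintegral (@integral_circle_FTC _ (fun t => t + F t)) /=.
  - by rewrite F0 add0r addrK divff // gt_eqF ?twopi_gt0.
  - by move=> t; apply: cvgD; [exact: cvg_cst|exact: fc].
  - by move=> t; have /andP[] := f1 t; lra.
rewrite RintegralD // Rintegral_cst // mul1r.
have -> : fine (mu setT) = 1 by rewrite probability_setT.
by move=> h; apply: (addrI 1); rewrite h addr0.
Qed.

Lemma circle_pt_2piz (k : int) : circle_pt (k%:~R * (2 * pi) : R) = 1.
Proof.
rewrite -circle_pt_exprz [X in X ^ k](_ : _ = 1) ?exp1rz //.
by rewrite /circle_pt mulr_natl cos2pi sin2pi.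
Qed.

Lemma Rintegral_circle_cos_sin (k : int) : k != 0 ->
  \int[mu]_t cos (k%:~R * t) = 0 /\ \int[mu]_t sin (k%:~R * t) = 0.
Proof.
move=> k0; have kR0 : k%:~R != 0 :> R by rewrite intr_eq0.
have [cosk sink] : cos (k%:~R * (2 * pi)) = 1 :> R /\ sin (k%:~R * (2 * pi)) = 0 :> R.
  by have [] := circle_pt_2piz k.
have lin_c : continuous (fun t : R => k%:~R * t).
  by move=> t; apply: cvgM; [exact: cvg_cst|exact: cvg_id].
have lin_d (t : R) : is_derive t 1 (fun t : R => k%:~R * t) k%:~R.
  by apply: is_derive_eq; rewrite /GRing.scale /= mulr1 ?addr0.
split.
- apply: (@Rintegral_circle_trig _ (fun t => k%:~R^-1 * sin (k%:~R * t))).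
  + by move=> t; apply: continuous_comp; [exact: lin_c|exact: continuous_cos].
  + by move=> t; rewrite cos_geN1 cos_le1.
  + move=> t; apply: is_derive_eq.
    by rewrite /GRing.scale /=; field.
  + by rewrite sink !mulr0 sin0 mulr0.
- apply: (@Rintegral_circle_trig _ (fun t => - k%:~R^-1 * cos (k%:~R * t))).
  + by move=> t; apply: continuous_comp; [exact: lin_c|exact: continuous_sin].
  + by move=> t; rewrite sin_geN1 sin_le1.
  + move=> t; apply: is_derive_eq.
    by rewrite /GRing.scale /=; field.
  + by rewrite cosk mulr0 cos0.
Qed.

Lemma sq_integrable_monomial (n : int) : sq_integrable (fun t : R => circle_pt t ^ n).
Proof. exact/asboolP/monomial_L2. Qed.

Lemma L2rep_zpow n : {ae mu, forall t, L2rep (zpow R n) t = circle_pt t ^ n}.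
Proof. exact: L2rep_pi. Qed.

Lemma zpow_orthonormal m n : L2ip (zpow R m) (zpow R n) = (m == n)%:R.
Proof.
rewrite (L2ip_ae (sq_integrable_monomial m) (sq_integrable_monomial n)
  (L2rep_zpow m) (L2rep_zpow n)).
have E (t : R) : circle_pt t ^ m * (circle_pt t ^ n)^* = circle_pt ((m - n)%:~R * t).
  rewrite !circle_pt_exprz rmorphB mulrBl /circle_pt cosB sinB.
  by apply/eqP; rewrite eq_complex /=; apply/andP; split; apply/eqP; ring.
under eq_Rintegral do rewrite E /=.
under [X in _ +i* X]eq_Rintegral do rewrite E /=.
have [->|mn] := eqVneq m n.
  under eq_Rintegral do rewrite subrr mul0r cos0.
  under [X in _ +i* X]eq_Rintegral do rewrite subrr mul0r sin0.
  rewrite !Rintegral_cst // mul0r mul1r.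
  by have -> : fine (mu setT) = 1 by rewrite probability_setT.
have mn0 : m - n != 0 by rewrite subr_eq0.
by have [-> ->] := Rintegral_circle_cos_sin mn0.
Qed.

Lemma circle_ptV_norm (t : R) (w : C) : sqr_abs (circle_pt t ^ (-1) * w) = sqr_abs w.
Proof.
rewrite circle_pt_exprz mulrN1z mulN1r /circle_pt cosN sinN !sqr_absE.
by have := cos2Dsin2 t; case: w => a b /=; move: (cos t) (sin t) => c s h; nra.
Qed.

(** On the circle the inverse of z is conj z. This multiplication operator is the concrete inverse
    and adjoint of the bilateral shift. *)
Definition conj_mul_fun (x : L2 R) : R -> C := fun t => circle_pt t ^ (-1) * L2rep x t.

Lemma conj_mul_L2 x : conj_mul_fun x \in @L2pred R.
Proof.
have [mr mi xI] := L2rep_sq_integrable x.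
have [cr ci _] := sq_integrable_monomial (-1).
apply/asboolP; split.
- rewrite [X in measurable_fun _ X](_ : _ = fun t => Re (circle_pt t ^ (-1)) * Re (L2rep x t)
      - Im (circle_pt t ^ (-1)) * Im (L2rep x t)).
    by apply: measurable_funB; exact: measurable_funM.
  by apply/funext => t; rewrite /conj_mul_fun; case: (_ ^ _) (L2rep x t) => ? ? [].
- rewrite [X in measurable_fun _ X](_ : _ = fun t => Re (circle_pt t ^ (-1)) * Im (L2rep x t)
      + Im (circle_pt t ^ (-1)) * Re (L2rep x t)).
    by apply: measurable_funD; exact: measurable_funM.
  by apply/funext => t; rewrite /conj_mul_fun; case: (_ ^ _) (L2rep x t) => ? ? [].
- by under eq_integral do rewrite circle_ptV_norm.
Qed.

Definition conj_mul (x : L2 R) : L2 R := \pi_L2R (MkL2fun (conj_mul_L2 x)).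

Lemma L2rep_conj_mul x :
  {ae mu, forall t, L2rep (conj_mul x) t = circle_pt t ^ (-1) * L2rep x t}.
Proof. exact: L2rep_pi. Qed.

Lemma conj_mul_linear : linear conj_mul.
Proof.
move=> a x y; apply: L2_eq_ae.
move: (L2rep_conj_mul (a *: x + y)) (L2rep_linear a x y) => h1 h2.
move: (L2rep_linear a (conj_mul x) (conj_mul y)) => h3.
move: (L2rep_conj_mul x) (L2rep_conj_mul y) => h4 h5.
near=> t.
have -> : L2rep (conj_mul (a *: x + y)) t = circle_pt t ^ (-1) * L2rep (a *: x + y) t.
  by near: t.
have -> : L2rep (a *: x + y) t = a * L2rep x t + L2rep y t by near: t.
have -> : L2rep (a *: conj_mul x + conj_mul y) t =
   a * L2rep (conj_mul x) t + L2rep (conj_mul y) t by near: t.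
have -> : L2rep (conj_mul x) t = circle_pt t ^ (-1) * L2rep x t by near: t.
have -> : L2rep (conj_mul y) t = circle_pt t ^ (-1) * L2rep y t by near: t.
by ring.
Unshelve. all: by end_near. Qed.

HB.instance Definition _ := GRing.isLinear.Build C (L2 R) (L2 R) *:%R conj_mul
  conj_mul_linear.

Lemma circle_pt_neq0 (t : R) : circle_pt t != 0.
Proof.
apply/eqP => -[c0 s0]; have := cos2Dsin2 t.
by rewrite c0 s0 expr0n addr0 => /eqP; rewrite eq_sym oner_eq0.
Qed.

Lemma conj_mul_zpow n : conj_mul (zpow R n) = zpow R (n - 1).
Proof.
apply: L2_eq_ae; move: (L2rep_conj_mul (zpow R n)) (L2rep_zpow n) (L2rep_zpow (n - 1)).
by apply: filterS3 => t /= -> -> ->; rewrite mulrC -expfzDr ?circle_pt_neq0.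
Qed.

Lemma L2norm_sqr x : Re (L2ip x x) = \int[mu]_t sqr_abs (L2rep x t).
Proof.
apply: eq_Rintegral => t _.
by rewrite sqr_absE; case: (L2rep x t) => a b /=; ring.
Qed.

Lemma bounded_conj_mul : bounded_operator (@L2ip R) conj_mul.
Proof.
exists 1 => x; rewrite mul1r /ip_norm !L2norm_sqr.
have [cr ci] := sq_integrable_measurable (L2rep_sq_integrable (conj_mul x)).
have [xr xi] := sq_integrable_measurable (L2rep_sq_integrable x).
rewrite (@Rintegral_ae _ _ (fun t => sqr_abs (L2rep x t))) //.
- by apply/measurable_EFinP; exact: (measurable_sqr_abs cr ci).
- by apply/measurable_EFinP; exact: (measurable_sqr_abs xr xi).
- by move: (L2rep_conj_mul x); apply: filterS => t /= ->; exact: circle_ptV_norm.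
Qed.

Definition trig_sum (s : seq (int * C)) (t : R) : C :=
  \sum_(k <- s) k.2 * circle_pt t ^ k.1.

Lemma L2rep_sum (s : seq (int * C)) :
  {ae mu, forall t, L2rep (\sum_(k <- s) k.2 *: zpow R k.1) t = trig_sum s t}.
Proof.
elim: s => [|k s IH].
  rewrite big_nil -L2_pi0.
  by move: (L2rep_pi (0 : L2fun R)); apply: filterS => t /= ->; rewrite /trig_sum big_nil.
rewrite big_cons; move: (L2rep_linear k.2 (zpow R k.1) (\sum_(k <- s) k.2 *: zpow R k.1)).
move: IH (L2rep_zpow k.1); apply: filterS3 => t /= h1 h2 ->.
by rewrite h1 h2 /trig_sum big_cons.
Qed.

End CircleMonomials.

(** * Density of the trigonometric polynomials *)

Section TrigonometricApproximation.
Variable R : realType.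
Local Notation C := R[i].
Local Notation mu := (circle_meas R).
Implicit Types (f g p : R -> C).

Definition trigonometric p : Prop := exists s, p =1 trig_sum s.

Lemma trigonometric_cst (c : C) : trigonometric (fun=> c).
Proof. by exists [:: (0, c)] => t; rewrite /trig_sum big_seq1 expr0z mulr1. Qed.

Lemma trigonometricD p q : trigonometric p -> trigonometric q ->
  trigonometric (fun t => p t + q t).
Proof.
by move=> [s ps] [r qr]; exists (s ++ r) => t; rewrite ps qr /trig_sum big_cat.
Qed.

Lemma trigonometricM p q : trigonometric p -> trigonometric q ->
  trigonometric (fun t => p t * q t).
Proof.
move=> [s ps] [r qr].
exists [seq (k.1 + l.1, k.2 * l.2) | k <- s, l <- r] => t.
rewrite ps qr /trig_sum big_allpairs_dep mulr_suml; apply: eq_bigr => k _.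
rewrite mulr_sumr; apply: eq_bigr => l _ /=.
by rewrite expfzDr ?circle_pt_neq0 //; ring.
Qed.

Lemma trigonometricX p n : trigonometric p -> trigonometric (fun t => p t ^+ n).
Proof.
move=> tp; elim: n => [|n IH].
  by under eq_fun do rewrite expr0; exact: trigonometric_cst.
by under eq_fun do rewrite exprS; exact: trigonometricM.
Qed.

Lemma trigonometricZ (c : C) p : trigonometric p -> trigonometric (fun t => c * p t).
Proof. by move=> tp; apply: trigonometricM => //; exact: trigonometric_cst. Qed.

Lemma trigonometric_cos (b : R) : trigonometric (fun t => (cos (t - b))%:C).
Proof.
(* Euler's formula: cos (t - b) is half of e^{-ib} z + e^{ib} z^{-1}. *)
exists [:: (1, circle_pt (- b) / 2); (- 1, circle_pt b / 2)] => t.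
rewrite /trig_sum big_cons big_seq1 /= !circle_pt_exprz mul1r mulrN1z mulN1r.
rewrite /circle_pt !cosN !sinN cosB.
have -> : (2 : C)^-1 = (2^-1 : R)%:C by rewrite fmorphV rmorph_nat.
by apply/eqP; rewrite eq_complex /=; apply/andP; split; apply/eqP; field.
Qed.

Lemma sq_integrable0 : sq_integrable (fun=> 0 : C).
Proof. by apply/asboolP; have [] := L2pred_submod_closed R. Qed.

Lemma trigonometric_sq_integrable p : trigonometric p -> sq_integrable p.
Proof.
move=> [s ps]; rewrite (_ : p = trig_sum s); last exact/funext.
elim: s {p ps} => [|k s IH].
  rewrite (_ : trig_sum _ = fun=> 0); first exact: sq_integrable0.
  by apply/funext => t; rewrite /trig_sum big_nil.
rewrite (_ : trig_sum _ = fun t => k.2 * circle_pt t ^ k.1 + trig_sum s t).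
  by apply: sq_integrable_linear => //; exact: sq_integrable_monomial.
by apply/funext => t; rewrite /trig_sum big_cons.
Qed.

Local Notation sqint f := (\int[mu]_t (sqr_abs (f t))%:E)%E.

Lemma sqr_absM (a b : C) : sqr_abs (a * b) = sqr_abs a * sqr_abs b.
Proof. by rewrite /sqr_abs Normc.normcM exprMn. Qed.

Lemma complex_measurable_linear a f g : complex_measurable f ->
  complex_measurable g -> complex_measurable (fun t => a * f t + g t).
Proof.
move=> [fr fi] [gr gi]; split.
- rewrite [X in measurable_fun _ X](_ : _ =
    fun t => Re a * Re (f t) - Im a * Im (f t) + Re (g t)).
    by apply: measurable_funD => //; apply: measurable_funB; exact: measurable_funM.
  by apply/funext => t; case: (a) (f t) (g t) => ? ? [? ?] [].
- rewrite [X in measurable_fun _ X](_ : _ =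
    fun t => Re a * Im (f t) + Im a * Re (f t) + Im (g t)).
    by apply: measurable_funD => //; apply: measurable_funD; exact: measurable_funM.
  by apply/funext => t; case: (a) (f t) (g t) => ? ? [? ?] [].
Qed.

Lemma complex_measurableB f g : complex_measurable f -> complex_measurable g ->
  complex_measurable (fun t => f t - g t).
Proof.
move=> mf mg; have := complex_measurable_linear (-1) mg mf.
by congr complex_measurable; apply/funext => t; rewrite mulN1r addrC.
Qed.

(** Pointwise |a f + g|^2 <= 2 |a|^2 |f|^2 + 2 |g|^2. The integrals are extended reals, so
    measurability is enough. *)
Lemma sqint_linear a f g : complex_measurable f -> complex_measurable g ->
  (sqint (fun t => a * f t + g t)
   <= (2 * sqr_abs a)%:E * sqint f + 2%:E * sqint g)%E.
Proof.
move=> mf mg; have [mh mh'] := complex_measurable_linear a mf mg.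
have c0 : 0 <= 2 * sqr_abs a by rewrite mulr_ge0 ?sqr_abs_ge0.
have Mf := measurable_sqr_abs mf.1 mf.2; have Mg := measurable_sqr_abs mg.1 mg.2.
rewrite -!ge0_integralZl //; try (by move=> t _; rewrite lee_fin sqr_abs_ge0).
rewrite -ge0_integralD //; last 4 first.
- by move=> t _; rewrite -EFinM lee_fin mulr_ge0 ?sqr_abs_ge0.
- exact: emeasurable_funM.
- by move=> t _; rewrite -EFinM lee_fin mulr_ge0 ?sqr_abs_ge0.
- exact: emeasurable_funM.
apply: ge0_le_integral => //.
- by move=> t _; rewrite lee_fin sqr_abs_ge0.
- exact: measurable_sqr_abs.
- by apply: emeasurable_funD; exact: emeasurable_funM.
- move=> t _; rewrite -!EFinM -EFinD lee_fin -mulrA -sqr_absM.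
  move: (a * f t) (g t) => [x y] [u v]; rewrite !sqr_absE /=.
  by have := sqr_ge0 (x - u); have := sqr_ge0 (y - v); nra.
Qed.

(** The squared L^2 distance is an extended real, so the notion applies before square integrability
    of [f] is known. *)
Definition trig_approximable f : Prop := forall eps : R, 0 < eps ->
  exists2 p, trigonometric p & (sqint (fun t => f t - p t) < eps%:E)%E.

Lemma trigonometric_approximable p : trigonometric p -> trig_approximable p.
Proof.
move=> tp eps eps0; exists p => //.
under eq_integral do rewrite subrr sqr_abs0.
by rewrite integral0 lte_fin.
Qed.

Lemma trig_approximable_linear a f g :
  complex_measurable f -> complex_measurable g ->
  trig_approximable f -> trig_approximable g ->
  trig_approximable (fun t => a * f t + g t).
Proof.
move=> mf mg af ag eps eps0.
(* The two errors contribute less than eps / 2 each after the factors 2 |a|^2 and 2; the summand 1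
   covers a = 0. *)
have c0 : 0 < 4 * (sqr_abs a + 1) by rewrite mulr_gt0 // ltr_wpDl ?sqr_abs_ge0.
have [p tp fp] := af (eps / (4 * (sqr_abs a + 1))) (divr_gt0 eps0 c0).
have [|q tq gq] := ag (eps / 4); first by rewrite divr_gt0.
exists (fun t => a * p t + q t).
  by apply: trigonometricD => //; exact: trigonometricZ.
have mp := sq_integrable_measurable (trigonometric_sq_integrable tp).
have mq := sq_integrable_measurable (trigonometric_sq_integrable tq).
have mfp := complex_measurableB mf mp.
have mgq := complex_measurableB mg mq.
have E t : a * f t + g t - (a * p t + q t) = a * (f t - p t) + (g t - q t) by ring.
under eq_integral do rewrite E.
apply: le_lt_trans (sqint_linear a mfp mgq) _.
have N0 h : (0 <= sqint h)%E by apply: integral_ge0 => t _; rewrite lee_fin sqr_abs_ge0.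
move: (N0 (fun t => f t - p t)) (N0 (fun t => g t - q t)) fp gq.
case: (sqint (fun t => f t - p t)) => [x| |] //.
case: (sqint (fun t => g t - q t)) => [y| |] //.
rewrite -!EFinM -EFinD !lte_fin !lee_fin => x0 y0; rewrite ltr_pdivlMr // => hx hy.
have A0 := sqr_abs_ge0 a; nra.
Qed.

Lemma trig_approximable_limit f (F : nat -> R -> C) :
  complex_measurable f -> (forall n, complex_measurable (F n)) ->
  (forall n, trig_approximable (F n)) ->
  sqint (fun t => f t - F n t) @[n --> \oo] --> 0%E ->
  trig_approximable f.
Proof.
move=> mf mF aF /fine_cvgP[Ffin Fcvg] eps eps0.
have e4 : 0 < eps / 4 by rewrite divr_gt0.
have [n [nfin nlt]] : exists n, sqint (fun t => f t - F n t) \is a fin_num /\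
    fine (sqint (fun t => f t - F n t)) < eps / 4.
  have /cvgrPdist_lt/(_ _ e4) h := Fcvg.
  have [n _ hn] := filterI Ffin h.
  exists n; have [/= h1 h2] := hn n (leqnn n); split => //.
  by apply: le_lt_trans h2; rewrite sub0r normrN ler_norm.
have [p tp Fp] := aF n _ e4; exists p => //.
have mp := sq_integrable_measurable (trigonometric_sq_integrable tp).
have mfF := complex_measurableB mf (mF n).
have mFp := complex_measurableB (mF n) mp.
have E t : f t - p t = 1 * (f t - F n t) + (F n t - p t) by ring.
under eq_integral do rewrite E.
apply: le_lt_trans (sqint_linear 1 mfF mFp) _.
have N0 : (0 <= sqint (fun t => F n t - p t))%E.
  by apply: integral_ge0 => t _; rewrite lee_fin sqr_abs_ge0.
have -> : sqr_abs (1 : C) = 1 by rewrite sqr_absE /= expr1n expr0n addr0.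
rewrite -(fineK nfin); move: nlt N0 Fp; move: (fine _) => x.
case: (sqint (fun t => F n t - p t)) => [y| |] //.
by rewrite -!EFinM -EFinD !lte_fin !lee_fin => ? ? ?; lra.
Qed.

Lemma real_complex_measurable (h : R -> R) : measurable_fun setT h ->
  complex_measurable (fun t => (h t)%:C).
Proof. by move=> mh; split => //=; exact: (@measurable_cst _ _ _ _ _ (0 : R)). Qed.

(** Dominated convergence for (h - F n)^2 turns almost everywhere limits into L^2 limits. *)
Lemma trig_approximable_dominated (h : R -> R) (F : nat -> R -> R) (G : R -> R) :
  measurable_fun setT h -> (forall n, measurable_fun setT (F n)) ->
  (forall n, trig_approximable (fun t => (F n t)%:C)) ->
  {ae mu, forall t, F n t @[n --> \oo] --> h t} ->
  mu.-integrable setT (EFin \o G) ->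
  (forall n t, (h t - F n t) ^+ 2 <= G t) ->
  trig_approximable (fun t => (h t)%:C).
Proof.
move=> mh mF aF Fh GI FG.
apply: (@trig_approximable_limit _ (fun n t => (F n t)%:C)) => //.
- by move=> n; exact: real_complex_measurable (mF n).
under eq_fun do (under eq_integral do rewrite -rmorphB sqr_absE /= expr0n addr0).
have mD n : measurable_fun setT (fun t => ((h t - F n t) ^+ 2)%:E).
  by apply/measurable_EFinP; apply: measurable_funX; exact: measurable_funB.
have [] := dominated_convergence (mu := mu) measurableT mD
  (f := fun=> 0%E) (g := EFin \o G); last by rewrite integral0.
- exact: measurable_cst.
- move: Fh; apply: filterS => t /= ht _.
  rewrite (_ : 0%E = (0 ^+ 2 : R)%:E); last by rewrite expr0n.
  apply: cvg_EFin; first exact: nearW.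
  rewrite /comp /= expr2; under eq_fun do rewrite expr2.
  have h0 : h t - F n t @[n --> \oo] --> (0 : R).
    by rewrite -(subrr (h t)); apply: cvgB; [exact: cvg_cst|exact: ht].
  exact: cvgM.
- exact: GI.
- by apply: aeW => t n _; rewrite /= lee_fin ger0_norm ?sqr_ge0.
Qed.

End TrigonometricApproximation.

(** * Indicators of Borel sets as limits of trigonometric polynomials *)

Section TrigonometricDensity.
Variable R : realType.
Local Notation C := R[i].
Local Notation mu := (circle_meas R).

Lemma circle_ae_neq (a : R) : {ae mu, forall t, t != a}.
Proof.
exists [set a]; split; first exact: measurable_set1.
  have /null_content_dominatesP := @dominates_uniform_prob R 0 (2 * pi) (twopi_gt0 R).
  by apply; [exact: measurable_set1|exact: lebesgue_measure_set1].
by move=> t /= /negP; rewrite negbK => /eqP.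
Qed.

Lemma circle_ae_itv : {ae mu, forall t, 0 < t < 2 * pi}.
Proof.
have : {ae mu, forall t, 0 <= t <= 2 * pi}.
  exists (~` `[0, 2 * pi]); split; first exact: measurableC.
    apply: etrans (integral_uniform_pdf 0 (2 * pi) _) _; rewrite setICl.
    by rewrite integral_set0.
  by move=> t /=; rewrite in_itv /=.
move: (circle_ae_neq 0) (circle_ae_neq (2 * pi)); apply: filterS3 => t.
by rewrite !lt_neqAle => h1 h2 /andP[-> ->]; rewrite h2 eq_sym h1.
Qed.

Lemma bernoulli_inequality (x : R) n : 0 <= x <= 1 -> 1 - n%:R * x <= (1 - x) ^+ n.
Proof.
move=> /andP[x0 x1]; elim: n => [|n IH]; first by rewrite mul0r subr0 expr0.
rewrite exprS; apply: le_trans (_ : (1 - x) * (1 - n%:R * x) <= _); last first.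
  by rewrite ler_wpM2l // subr_ge0.
rewrite -addn1 natrD; have := ler0n R n; move: (n%:R) => m m0.
by have := mulr_ge0 m0 (sqr_ge0 x); nra.
Qed.

Lemma bernoulli_inequality_inv (x : R) n :
  0 <= x <= 1 -> (1 - x) ^+ n * (1 + n%:R * x) <= 1.
Proof.
move=> /andP[x0 x1]; elim: n => [|n IH]; first by rewrite mul0r addr0 expr0 mulr1.
apply: le_trans IH; rewrite exprSr -mulrA ler_wpM2l ?exprn_ge0 ?subr_ge0 //.
rewrite -addn1 natrD; have := ler0n R n; move: (n%:R) => m m0.
by have := mulr_ge0 m0 (sqr_ge0 x); nra.
Qed.

(* The polynomials of the Brosowski-Deutsch proof of Stone-Weierstrass:
   [(1 - u^n)^(2^n)] tends to the indicator of [u < 1/2] for [u] in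
   [[0, 1] \ {1/2}]. *)
Lemma step_polynomial_lt (u : R) : 0 <= u < 2^-1 ->
  (1 - u ^+ n) ^+ (2 ^ n) @[n --> \oo] --> (1 : R).
Proof.
move=> /andP[u0 u1].
have u01 n : 0 <= u ^+ n <= 1 by rewrite exprn_ge0 //= exprn_ile1 //; lra.
(* Bernoulli's inequality with exponent 2^n gives the lower bound 1 - 2^n u^n = 1 - (2 u)^n. *)
apply: (@squeeze_cvgr _ _ _ _ (fun n => 1 - (2 * u) ^+ n) (fun=> 1)).
- apply: nearW => n; have /andP[h1 h2] := u01 n; apply/andP; split.
    apply: le_trans (bernoulli_inequality (2 ^ n) (u01 n)).
    by rewrite natrX exprMn.
  by rewrite exprn_ile1 //; lra.
- rewrite -[X in _ --> X]subr0; apply: cvgB; first exact: cvg_cst.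
  by apply: cvg_expr; rewrite ger0_norm; lra.
- exact: cvg_cst.
Qed.

Lemma step_polynomial_gt (u : R) : 2^-1 < u <= 1 ->
  (1 - u ^+ n) ^+ (2 ^ n) @[n --> \oo] --> (0 : R).
Proof.
move=> /andP[u0 u1].
have u01 n : 0 <= u ^+ n <= 1 by rewrite exprn_ge0 ?exprn_ile1 //; lra.
have u2 : 0 < 2 * u by lra.
(* The inverse form of Bernoulli's inequality gives the upper bound 1 / (1 + (2 u)^n) <= (2
   u)^{-n}. *)
apply: (@squeeze_cvgr _ _ _ _ (fun=> 0) (fun n => ((2 * u)^-1) ^+ n)).
- apply: nearW => n; have /andP[h1 h2] := u01 n; apply/andP; split.
    by rewrite exprn_ge0 // subr_ge0.
  rewrite exprVn -[leRHS]mul1r ler_pdivlMr ?exprn_gt0 //.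
  apply: le_trans (bernoulli_inequality_inv (2 ^ n) (u01 n)).
  by rewrite natrX exprMn ler_wpM2l ?exprn_ge0 ?subr_ge0 // lerDr.
- exact: cvg_cst.
- apply: cvg_expr; rewrite ger0_norm ?invr_ge0 ?(ltW u2) // invf_lt1 //; lra.
Qed.

Lemma circle_integrable_cst (c : R) : mu.-integrable setT (EFin \o (fun=> c)).
Proof. exact: finite_measure_integrable_cst. Qed.

Let approximable (A : set R) := trig_approximable (fun t : R => (\1_A t : R)%:C).

Lemma approximable_ae (A B : set R) : {ae mu, forall t, A t <-> B t} ->
  measurable A -> measurable B -> approximable A -> approximable B.
Proof.
move=> AB mA mB aA.
apply: (@trig_approximable_dominated _ _ (fun _ => \1_A) (fun=> 1)) => //.
- move: AB; apply: filterS => t AB.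
  rewrite (_ : \1_B t = \1_A t :> R); first exact: cvg_cst.
  rewrite !indicE (_ : (t \in B) = (t \in A)) //.
  by apply/idP/idP; rewrite !inE => /AB.
- exact: circle_integrable_cst.
Qed.

Lemma approximableT : approximable setT.
Proof.
rewrite /approximable indicT; apply: trigonometric_approximable.
exact: (trigonometric_cst 1).
Qed.

Lemma approximable0 : approximable set0.
Proof.
rewrite /approximable indic0; apply: trigonometric_approximable.
exact: (trigonometric_cst 0).
Qed.

(* For [0 < t < 2 pi], the trigonometric polynomial
   [cos (a / 2) - cos (t - a / 2) = 2 sin (t / 2) sin ((t - a) / 2)]
   has the sign of [t - a]. *)
Lemma approximable_ray_in (a : R) : 0 <= a <= 2 * pi -> approximable `]a, +oo[.
Proof.
move=> /andP[a0 a2].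
pose g t : R := cos (a / 2) - cos (t - a / 2).
have gE t : g t = 2 * (sin (t / 2) * sin ((t - a) / 2)).
  rewrite /g; set x := t / 2; set y := (t - a) / 2.
  have -> : a / 2 = x - y by rewrite /x /y; field.
  have -> : t - (x - y) = x + y by rewrite /x /y; field.
  by rewrite cosB cosD; ring.
(* As |g| <= 2, this maps into [0, 1], and u < 1/2 exactly when g > 0. *)
pose u t : R := (2 - g t) / 4.
have u01 t : 0 <= u t <= 1.
  rewrite /u /g; have := cos_le1 (a / 2); have := cos_geN1 (a / 2).
  have := cos_le1 (t - a / 2); have := cos_geN1 (t - a / 2); lra.
have tu : trigonometric (fun t => (u t)%:C).
  have := trigonometricD (trigonometric_cst ((2 - cos (a / 2)) / 4)%:C)
    (trigonometricZ (4^-1)%:C (trigonometric_cos (a / 2))).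
  congr trigonometric; apply/funext => t /=.
  by rewrite -rmorphM -rmorphD; congr (_%:C); rewrite /u /g; field.
have mu_ : measurable_fun setT u.
  apply: measurable_funM => //; do 2 (apply: measurable_funB => //).
  apply: measurableT_comp.
    by apply: continuous_measurable_fun => ?; exact: continuous_cos.
  exact: measurable_funB.
pose F n t : R := (1 - u t ^+ n) ^+ (2 ^ n).
have F01 n t : 0 <= F n t <= 1.
  have /andP[h1 h2] := u01 t.
  have h : 0 <= 1 - u t ^+ n <= 1.
    by have := exprn_ge0 n h1; have := exprn_ile1 n h1 h2; lra.
  by have /andP[h3 h4] := h; rewrite exprn_ge0 // exprn_ile1.
apply: (@trig_approximable_dominated _ _ F (fun=> 1)).
- exact: measurable_indic.
- by move=> n; apply: measurable_funX; apply: measurable_funB => //; exact: measurable_funX.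
- move=> n; apply: trigonometric_approximable.
  have := trigonometricX (2 ^ n) (trigonometricD (trigonometric_cst 1)
    (trigonometricZ (- 1) (trigonometricX n tu))).
  congr trigonometric; apply/funext => t /=.
  by rewrite /F rmorphXn rmorphB rmorphXn rmorph1 mulN1r.
(* For 0 < t < 2 pi both t / 2 and |t - a| / 2 are below pi, so the sines have known signs; t = a,
   where u = 1/2, is a null set. *)
- move: (circle_ae_neq a) circle_ae_itv; apply: filterS2 => t ta /andP[t0 t2].
  have s0 : 0 < sin (t / 2) by apply: sin_gt0_pi; apply/andP; split; lra.
  have /andP[ut0 ut1] := u01 t.
  have [at_|at_|] := ltgtP a t; last by move=> ae; rewrite ae eqxx in ta.
  + rewrite (_ : \1_`]a, +oo[ t = 1 :> R); last first.
      by rewrite indicE mem_set //= in_itv /= at_.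
    apply: (@step_polynomial_lt (u t)).
    rewrite ut0 /u gE.
    have : 0 < sin ((t - a) / 2) by apply: sin_gt0_pi; apply/andP; split; lra.
    by move=> h; have := mulr_gt0 s0 h; lra.
  + rewrite (_ : \1_`]a, +oo[ t = 0 :> R); last first.
      by rewrite indicE memNset //= in_itv /= (lt_gtF at_).
    apply: (@step_polynomial_gt (u t)).
    rewrite ut1 andbT /u gE.
    have : 0 < sin (- ((t - a) / 2)) by apply: sin_gt0_pi; apply/andP; split; lra.
    by rewrite sinN => h; have := mulr_gt0 s0 h; lra.
- exact: circle_integrable_cst.
- move=> n t; have := F01 n t; rewrite indicE; case: (_ \in _) => /=; nra.
Qed.

Lemma approximable_ray (a : R) : approximable `]a, +oo[.
Proof.
(* Up to a null set, a ray starting outside [0, 2 pi] is everything or empty. *)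
have [a0|a0] := ltP a 0.
  apply: approximable_ae approximableT => //.
  move: circle_ae_itv; apply: filterS => t /andP[t0 _]; split => //= _.
  by rewrite in_itv /= andbT (lt_trans a0).
have [a2|a2] := ltP (2 * pi) a; last by apply: approximable_ray_in; rewrite a0.
apply: approximable_ae approximable0 => //.
move: circle_ae_itv; apply: filterS => t /andP[_ t2]; split => //=.
by rewrite in_itv /= andbT => at_; have := lt_trans a2 (lt_trans at_ t2); rewrite ltxx.
Qed.

Lemma indic_complex_measurable (A : set R) : measurable A ->
  complex_measurable (fun t => (\1_A t)%:C).
Proof.
move=> mA; apply: (real_complex_measurable (h := \1_A)).
by apply: measurable_indic; exact: mA.
Qed.

Lemma approximable_measurable (A : set R) : measurable A -> approximable A.
Proof.
move=> mA; have GE := RGenOInfty.measurableE R.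
apply: (@dynkin_induction _ (measurableTypeR R) (@RGenOInfty.G R) approximable
  _ _ _ _ _ _ A _) => //.
- move=> _ _ [a ->] [b ->]; exists (Num.max a b); apply/seteqP; split => t /=;
  by rewrite !in_itv /= !andbT gt_max => /andP.
- exact: approximableT.
- by move=> _ [a ->]; exact: approximable_ray.
- move=> B mB aB.
  have h1 := indic_complex_measurable mB.
  have h2 : complex_measurable (fun=> 1 : C).
    exact: (real_complex_measurable (measurable_cst (1 : R))).
  have := trig_approximable_linear (-1) h1 h2 aB
    (trigonometric_approximable (trigonometric_cst 1)).
  congr trig_approximable; apply/funext => t.
  by rewrite mulN1r !indicE in_setC; case: (t \in B); rewrite /= !rmorph_nat; ring.
- move=> F mF tF aF.
  pose S n := \big[setU/set0]_(k < n) F k.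
  have mS n : measurable (S n) by exact: bigsetU_measurable.
  apply: (@trig_approximable_dominated _ _ (fun n => \1_(S n)) (fun=> 1)).
  + by apply: measurable_indic; apply: bigcup_measurable => k _; exact: mF.
  + by move=> n; apply: measurable_indic; exact: mS.
  (* By disjointness the indicator of S (n + 1) is the sum of those of F n and S n. *)
  + elim=> [|n IH]; first by rewrite /S big_ord0; exact: approximable0.
    have := trig_approximable_linear 1 (indic_complex_measurable (mF n))
      (indic_complex_measurable (mS n)) (aF n) IH.
    congr trig_approximable; apply/funext => t.
    rewrite mul1r -rmorphD; congr (_%:C); rewrite /S big_ord_recr /= !indicE in_setU.
    case Sn : (t \in \big[setU/set0]_(k < n) F k); case Fn : (t \in F n);
      rewrite ?addr0 ?add0r //.
    move: Sn Fn => /set_mem + /set_mem Fn; rewrite -bigcup_mkord => -[k kn Fk].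
    have kE : k = n by apply: tF => //; exists t.
    by move: kn; rewrite /= kE ltnn.
  + apply: aeW => t; apply: cvg_near_cst.
    have [[k _ Fk]|nF] := pselect ((\bigcup_k F k) t).
      exists k.+1 => // n /= kn; rewrite !indicE !mem_set //; first by exists k.
      by rewrite /S -bigcup_mkord; exists k.
    apply: nearW => n; rewrite !indicE !memNset //.
    by rewrite /S -bigcup_mkord => -[k _ Fk]; apply: nF; exists k.
  + exact: circle_integrable_cst.
  + move=> n t; rewrite !indicE; case: (_ \in _); case: (_ \in _);
    by rewrite ?subrr ?subr0 ?sub0r ?sqrrN ?expr1n ?expr0n.
(* The Borel sets, defined from half-open intervals, are also generated by the open rays. *)
- by move: mA; rewrite -[measurable A]/((@ocitv R).-sigma.-measurable A) GE.
Qed.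

End TrigonometricDensity.

(** * From simple functions to all square integrable functions *)

Section L2Density.
Variable R : realType.
Local Notation C := R[i].
Local Notation mu := (circle_meas R).
Import HBNNSimple.

Lemma trig_approximable_nnsfun (h : {nnsfun (measurableTypeR R) >-> R}) :
  trig_approximable (fun t : R => (h t)%:C).
Proof.
have finr : finite_set (range h) by exact: fimfunP.
rewrite (_ : (fun t => _) = fun t => \sum_(y <- fset_set (range h))
    y%:C * (\1_(h @^-1` [set y]) t)%:C); last first.
  apply/funext => t; rewrite {1}(fimfunE h t) fsbig_finite // rmorph_sum.
  by apply: eq_bigr => y _; rewrite rmorphM.
elim: (fset_set _ : seq R) => [|y s IH].
  under eq_fun do rewrite big_nil.
  exact/trigonometric_approximable/trigonometric_cst.
under eq_fun do rewrite big_cons.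
have mA (z : R) : measurable (h @^-1` [set z]).
  by apply: measurable_funPTI; exact: measurable_set1.
have m1 z : complex_measurable (fun t : R => (\1_(h @^-1` [set z]) t)%:C).
  by apply: indic_complex_measurable; exact: mA.
apply: trig_approximable_linear => //; last by apply: approximable_measurable; exact: mA.
elim: s {IH} => [|z s IH].
  under eq_fun do rewrite big_nil.
  exact: (real_complex_measurable (measurable_cst (0 : R))).
under eq_fun do rewrite big_cons.
exact: complex_measurable_linear.
Qed.

(** Increasing simple functions satisfy 0 <= F n <= h, so (h - F n)^2 is dominated by h^2. *)
Lemma trig_approximable_ge0 (h : R -> R) : measurable_fun setT h ->
  (forall t, 0 <= h t) -> mu.-integrable setT (EFin \o (fun t => h t ^+ 2)) ->
  trig_approximable (fun t : R => (h t)%:C).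
Proof.
move=> mh h0 hI.
have mEh : measurable_fun setT (EFin \o h : measurableTypeR R -> \bar R).
  exact/measurable_EFinP.
pose F := nnsfun_approx measurableT mEh.
have Fcvg t : F n t @[n --> \oo] --> h t.
  have /(_ t Logic.I) := cvg_nnsfun_approx measurableT mEh
    (fun x _ => (h0 x : (0 <= (h x)%:E)%E)).
  by move/fine_cvgP => [].
have Fle n t : F n t <= h t.
  rewrite -(cvg_lim _ (Fcvg t)) //; apply: nondecreasing_cvgn_le.
    by move=> a b ab; exact/lefP/nd_nnsfun_approx.
  by apply/cvg_ex; exists (h t); exact: Fcvg.
apply: (@trig_approximable_dominated _ _ (fun n => F n) (fun t => h t ^+ 2)) => //.
- by move=> n; exact: (measurable_funPT (F n)).
- by move=> n; exact: (trig_approximable_nnsfun (F n)).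
- by apply: aeW => t; exact: Fcvg.
- move=> n t; have F0 : 0 <= F n t by [].
  by have := Fle n t; nra.
Qed.

Lemma trig_approximable_real (h : R -> R) : measurable_fun setT h ->
  mu.-integrable setT (EFin \o (fun t => h t ^+ 2)) ->
  trig_approximable (fun t : R => (h t)%:C).
Proof.
move=> mh hI.
pose hp t := Num.max (h t) 0; pose hn t := Num.max (- h t) 0.
have mp : measurable_fun setT hp by exact: measurable_maxr.
have mn : measurable_fun setT hn by apply: measurable_maxr => //; exact: measurableT_comp.
have le_sq (k : R -> R) : measurable_fun setT k -> (forall t, k t ^+ 2 <= h t ^+ 2) ->
    mu.-integrable setT (EFin \o (fun t => k t ^+ 2)).
  move=> mk kh; apply: (le_integrable measurableT _ _ hI).
    by apply/measurable_EFinP; exact: measurable_funX.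
  by move=> t _; rewrite /= lee_fin !ger0_norm ?sqr_ge0.
have ap : trig_approximable (fun t : R => (hp t)%:C).
  apply: trig_approximable_ge0 => //; first by move=> t; rewrite le_max lexx orbT.
  apply: le_sq => // t; rewrite /hp; case: (leP (h t) 0) => _;
  by rewrite ?lexx ?expr0n ?sqr_ge0.
have an : trig_approximable (fun t : R => (hn t)%:C).
  apply: trig_approximable_ge0 => //; first by move=> t; rewrite le_max lexx orbT.
  apply: le_sq => // t; rewrite /hn; case: (leP (- h t) 0) => _;
  by rewrite ?sqrrN ?lexx ?expr0n ?sqr_ge0.
have := trig_approximable_linear (-1) (real_complex_measurable mn)
  (real_complex_measurable mp) an ap.
congr trig_approximable; apply/funext => t; rewrite mulN1r addrC -rmorphB; congr (_%:C).
by rewrite /hp /hn; case: (leP (h t) 0) => h1; case: (leP (- h t) 0) => h2; lra.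
Qed.

Lemma sq_integrable_approximable (f : R -> C) : sq_integrable f -> trig_approximable f.
Proof.
move=> fI; have [fr fi _] := fI; have f2 := sqr_abs_integrable fI.
have ap (k : R -> R) : measurable_fun setT k -> (forall t, k t ^+ 2 <= sqr_abs (f t)) ->
    trig_approximable (fun t => (k t)%:C).
  move=> mk kf; apply: trig_approximable_real => //.
  apply: (le_integrable measurableT _ _ f2).
    by apply/measurable_EFinP; exact: measurable_funX.
  by move=> t _; rewrite /= lee_fin !ger0_norm ?sqr_ge0 ?sqr_abs_ge0.
have ar : trig_approximable (fun t => (Re (f t))%:C).
  by apply: ap => // t; rewrite sqr_absE lerDl sqr_ge0.
have ai : trig_approximable (fun t => (Im (f t))%:C).
  by apply: ap => // t; rewrite sqr_absE lerDr sqr_ge0.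
have := trig_approximable_linear (0 +i* 1) (real_complex_measurable fi)
  (real_complex_measurable fr) ai ar.
congr trig_approximable; apply/funext => t.
by case: (f t) => a b; apply/eqP; rewrite eq_complex /=; apply/andP; split; apply/eqP; ring.
Qed.

Lemma zpow_basis : orthonormal_basis (@L2ip R) (zpow R).
Proof.
split; first exact: zpow_orthonormal.
move=> x eps eps0.
(* Approximability is measured by the squared norm, hence eps^2. *)
have e2 : 0 < eps ^+ 2 by rewrite exprn_gt0.
have [p [s ps] xs] := sq_integrable_approximable (L2rep_sq_integrable x) e2.
have pE : p = trig_sum s by exact/funext.
rewrite {p ps}pE in xs.
exists s; set y := \sum_(k <- s) _.
rewrite (norm_lt (L2ip_inner_product R)) // L2norm_sqr.
have ts : trigonometric (trig_sum s) by exists s.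
have mx := sq_integrable_measurable (L2rep_sq_integrable x).
have mp := sq_integrable_measurable (trigonometric_sq_integrable ts).
have mxp := complex_measurableB mx mp.
have [mr mi] := sq_integrable_measurable (L2rep_sq_integrable (x - y)).
rewrite (@Rintegral_ae _ _ (fun t => sqr_abs (L2rep x t - trig_sum s t))).
- rewrite -lte_fin fineK // ge0_fin_numE; first exact: lt_le_trans xs (leey _).
  by apply: integral_ge0 => t _; rewrite lee_fin sqr_abs_ge0.
- by apply/measurable_EFinP; exact: (measurable_sqr_abs mr mi).
- by apply/measurable_EFinP; exact: (measurable_sqr_abs mxp.1 mxp.2).
- move: (L2rep_linear (-1) y x) (L2rep_sum s); apply: filterS2 => t.
  by rewrite scaleN1r addrC => -> ->; rewrite mulN1r addrC.
Qed.

End L2Density.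

(** * The weights of the shift for |lambda| < 1 *)

Section ShiftWeights.
Variables (R : realType) (lambda : R).
Hypothesis lambda_itv : -1 < lambda < 1.

Local Notation d n := ((lambda + 2 * n%:~R + 1)^-1).

Lemma sqr_inv_le (x y : R) : 0 < y -> y <= `|x| -> x^-1 ^+ 2 <= y^-1 ^+ 2.
Proof.
move=> y0 yx; have x0 : 0 < `|x| := lt_le_trans y0 yx.
rewrite -[leLHS]real_normK ?num_real // normfV.
by rewrite ler_pXn2r ?nnegrE ?invr_ge0 ?(ltW x0) ?(ltW y0) // lef_pV2.
Qed.

Lemma sqr_inv_lt (x y : R) : 0 < y -> y < x -> x^-1 ^+ 2 < y^-1 ^+ 2.
Proof.
move=> y0 yx; have x0 : 0 < x := lt_trans y0 yx.
by rewrite ltr_pXn2r ?nnegrE ?invr_ge0 ?(ltW x0) ?(ltW y0) // ltf_pV2.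
Qed.

Lemma int_ge0_or_leN1 (n : int) : (0 <= n%:~R :> R) \/ (n%:~R <= -1 :> R).
Proof.
have [n0|n0] := leP 0 n; [left|right]; first by rewrite ler0z.
by rewrite -(mulrN1z 1) ler_int -ltzD1.
Qed.

(** The denominator is positive for n >= 0 and negative for n <= -1, because |lambda| < 1. *)
Lemma shift_weight_neq0 (n : int) : d n != 0.
Proof.
have /andP[l1 l2] := lambda_itv.
rewrite invr_eq0; have [n0|n0] := int_ge0_or_leN1 n.
  by rewrite gt_eqF //; lra.
by rewrite lt_eqF //; lra.
Qed.

Lemma shift_weight01 : d 0 + d 1 != 0.
Proof.
have /andP[l1 l2] := lambda_itv.
by rewrite gt_eqF // addr_gt0 // invr_gt0; lra.
Qed.

(** Here p, m, p', m' are the squares of d_0, d_{-1}, d_1, d_{-2}. As |d_n| decreases away from n =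
    0 and n = -1 on either side, the sum is at most p + p' for n >= 1 and at most m + m' for n <=
    -1. Both are below p + m since p' < m (from lambda > -1) and m' < p (from lambda < 1). *)
Lemma shift_weight_max : exists2 theta, 0 <= theta < 1 &
  forall n : int, n != 0 ->
    d n ^+ 2 + d (n - 1) ^+ 2 <= theta * (d 0 ^+ 2 + d (- 1) ^+ 2).
Proof.
have /andP[l1 l2] := lambda_itv.
pose p := (1 + lambda)^-1 ^+ 2; pose m := (1 - lambda)^-1 ^+ 2.
pose p' := (lambda + 3)^-1 ^+ 2; pose m' := (3 - lambda)^-1 ^+ 2.
have p'm : p' < m by apply: sqr_inv_lt; lra.
have m'p : m' < p by apply: sqr_inv_lt; lra.
have [p0 m0 p'0 m'0] : [/\ 0 < p, 0 < m, 0 <= p' & 0 <= m'].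
  by split; rewrite ?sqr_ge0 // exprn_gt0 // invr_gt0; lra.
have h0E : d 0 ^+ 2 + d (- 1) ^+ 2 = p + m.
  rewrite /p /m mulr0 addr0 [lambda + 1]addrC; congr (_ + _).
  have -> : lambda + 2 * (- 1) + 1 = - (1 - lambda) by ring.
  by rewrite invrN sqrrN.
have pm0 : 0 < p + m by rewrite addr_gt0.
exists (Num.max ((p + p') / (p + m)) ((m + m') / (p + m))).
  rewrite le_max gt_max !ltr_pdivrMr // divr_ge0 ?addr_ge0 ?(ltW p0) ?(ltW m0) //=.
  by apply/andP; split; lra.
move=> n n0; rewrite h0E -ler_pdivrMr // le_max !ler_pM2r ?invr_gt0 //.
have [n1|n1] := ltP 0 n.
- have n1R : 1 <= n%:~R :> R by rewrite ler1z -gtz0_ge1.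
  apply/orP; left; rewrite addrC; apply: lerD; rewrite ?rmorphB /=.
    by apply: sqr_inv_le; [lra|rewrite ger0_norm; lra].
  by apply: sqr_inv_le; [lra|rewrite ger0_norm; lra].
- have nN1 : n%:~R <= -1 :> R.
    have [h|//] := int_ge0_or_leN1 n; move: h; rewrite ler0z => h.
    by move: n0; rewrite eq_le n1 h.
  apply/orP; right; apply: lerD; rewrite ?rmorphB /=.
    by apply: sqr_inv_le; [lra|rewrite ler0_norm; lra].
  by apply: sqr_inv_le; [lra|rewrite ler0_norm; lra].
Qed.

End ShiftWeights.

(** * The given shifts as an instance of the abstract block operator *)

Theorem theorem4p8 (R : realType) (lambda alpha : R)
    (B S : {linear L2 R -> L2 R}) :
  -1 < lambda -> lambda < 1 -> 0 < alpha ->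
  weighted_shift (fun _ : int => 1) B ->
  weighted_shift (fun n : int => (lambda + 2 * n%:~R + 1)^-1) S ->
  irreducible (sum_ip (@L2ip R)) (upper_block B (alpha%:C \*: S) B).
Proof.
move=> l1 l2 a0 [Bbd Be] [Sbd Se] M redM.
have ipP := L2ip_inner_product R; have eP := zpow_basis R.
have Be' n : B (zpow R n) = zpow R (n + 1) by rewrite Be scale1r.
pose W : {linear L2 R -> L2 R} := @conj_mul R.
have Wbd : bounded_operator (@L2ip R) W := @bounded_conj_mul R.
have We n : W (zpow R n) = zpow R (n - 1) := conj_mul_zpow R n.
have idbd : bounded_operator (@L2ip R) idfun by exists 1 => x; rewrite mul1r.
(* [B] is known only on the basis and as bounded, so its relations with [W] are checked there and
   extended by density. *)
have BK : cancel B W.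
  apply: (eq_on_basis ipP eP (A := W \o B) (A' := idfun)) => //.
    exact: bounded_comp.
  by move=> n; rewrite /= Be' We addrK.
have WK : cancel W B.
  apply: (eq_on_basis ipP eP (A := B \o W) (A' := idfun)) => //.
    exact: bounded_comp.
  by move=> n; rewrite /= We Be' subrK.
have BW : adjoint_pair (@L2ip R) B W.
  apply: (adjoint_on_basis ipP eP) => // n m.
  by rewrite Be' We !zpow_orthonormal -subr_eq opprK.
pose d (n : int) : R := (lambda + 2 * n%:~R + 1)^-1.
pose D : {linear L2 R -> L2 R} := W \o S.
have De n : D (zpow R n) = (d n)%:C *: zpow R n.
  by rewrite /= Se linearZ_LR /= We addrK.
have Dbd : bounded_operator (@L2ip R) D by exact: bounded_comp.
have DD : adjoint_pair (@L2ip R) D D.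
  apply: (adjoint_on_basis ipP eP) => // n m.
  rewrite !De (ipZl ipP) (ipZr ipP) conj_real zpow_orthonormal.
  by case: eqP => [->|_] //; rewrite !mulr0.
(* As [W] is a right inverse of [B], the product B D is S. *)
have TE x : upper_block B (alpha%:C \*: S) B x = (B (x.1 + alpha%:C *: D x.2), B x.2).
  by rewrite /upper_block /= linearD linearZ_LR /= WK.
have lam : -1 < lambda < 1 by rewrite l1.
have [theta th dmax] := shift_weight_max lam.
have aN0 : alpha != 0 by rewrite gt_eqF.
exact: (block_irreducible ipP eP Bbd Wbd Dbd BK WK BW DD Be' De aN0
  (shift_weight_neq0 lam) (shift_weight01 lam) th dmax TE redM).
Qed.
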